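(* Let $\nu\in{}^\theta\mathbb{N}I$, and write $\nu=\sum_{i\in I}\tilde\nu_i\, i+\sum_{i\in I}\tilde\nu_i\, i^{-1}$ with $\tilde\nu_i\in\mathbb{Z}_{\ge0}$; set $\tilde\nu=\sum_{i\in I}\tilde\nu_i\, i\in\mathbb{N}I$. Suppose that $i+i^{-1}$ is not a summand of $\tilde\nu$ for any $i\in I$ (i.e. for no $i\in I$ are both $\tilde\nu_i\geq1$ and $\tilde\nu_{i^{-1}}\ge1$). Then $\tilde\nu$ yields an idempotent subalgebra $\mathbf{R}_{\tilde\nu}$ of $\mathfrak{W}_\nu$; that is, there is an idempotent $\mathbf{e}\in\mathfrak{W}_\nu$ and a $\mathbf{k}$-algebra isomorphism $\mathbf{e}\mathfrak{W}_\nu\mathbf{e}\cong\mathbf{R}_{\tilde\nu}$.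
   Context: **Setting.** $\mathbf{k}$ is a field with $\operatorname{char}\mathbf{k}\neq 2$; $p,q\in\mathbf{k}^\times$ are fixed with $p\neq\pm1$, $p$ not a power of $q$ and $q$ not a power of $p$. $\mathbb{Z}\rtimes\mathbb{Z}_2$ acts on $\mathbf{k}^\times$ by $(n,\varepsilon)\cdot\lambda=p^{2n}\lambda^{\varepsilon}$, $\varepsilon\in\{\pm1\}$. $I=\{p^{2n}\lambda^{\pm1}\mid n\in\mathbb{Z}\}$ is an orbit with $\pm1\notin I$. $\Gamma_I$ is the quiver with vertex set $I$ and one arrow $p^2i\to i$ for every $i\in I$. ${}^\theta\mathbb{N}I$ is the set of formal sums $\nu=\sum_{i\in I}\nu_i i$ with finite support, $\nu_i\in\mathbb{Z}_{\ge0}$ and $\nu_i=\nu_{i^{-1}}$; $|\nu|=\sum_i\nu_i=2m$. ${}^\theta I^\nu=\{\mathbf{i}\in I^m\mid\sum_k i_k+\sum_k i_k^{-1}=\nu\}$ (formal sums). $\mathbb{N}I$ is the set of formal sums $\tilde\nu=\sum_{i\in I}\tilde\nu_i i$ with finite support and $\tilde\nu_i\in\mathbb{Z}_{\ge0}$; $|\tilde\nu|=\sum\tilde\nu_i$; for $|\tilde\nu|=m$, $I^{\tilde\nu}=\{\mathbf{i}\in I^m\mid\sum_ki_k=\tilde\nu\}$. **Arrow notation.** $i\to j$ (equivalently $j\leftarrow i$): there is an arrow from $i$ to $j$ and none from $j$ to $i$; $i\leftrightarrow j$: arrows in both directions; $i\nleftrightarrow j$: $i\ne j$ and no arrows between them;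 $|i\to j|$ is the number of arrows from $i$ to $j$. **KLR algebra.** For $\tilde\nu\in\mathbb{N}I$ with $|\tilde\nu|=m$, $\mathbf{R}_{\tilde\nu}$ is the graded $\mathbf{k}$-algebra generated by $x_1,\dots,x_m$, $\sigma_1,\dots,\sigma_{m-1}$ and $\mathbf{e}(\mathbf{i})$, $\mathbf{i}\in I^{\tilde\nu}$, with relations ($s_k$ swaps entries $k,k+1$): (1) $\mathbf{e}(\mathbf{i})\mathbf{e}(\mathbf{j})=\delta_{\mathbf{ij}}\mathbf{e}(\mathbf{i})$, $\sigma_k\mathbf{e}(\mathbf{i})=\mathbf{e}(s_k\mathbf{i})\sigma_k$, $x_l\mathbf{e}(\mathbf{i})=\mathbf{e}(\mathbf{i})x_l$, $\sum_{\mathbf{i}}\mathbf{e}(\mathbf{i})=1$. (2) The $x_l$ commute. (3) $\sigma_k^2\mathbf{e}(\mathbf{i})$ equals $\mathbf{e}(\mathbf{i})$ if $i_k\nleftrightarrow i_{k+1}$; $(x_{k+1}-x_k)\mathbf{e}(\mathbf{i})$ if $i_k\leftarrow i_{k+1}$; $(x_k-x_{k+1})\mathbf{e}(\mathbf{i})$ if $i_k\to i_{k+1}$; $(x_{k+1}-x_k)(x_k-x_{k+1})\mathbf{e}(\mathbf{i})$ if $i_k\leftrightarrow i_{k+1}$; $0$ if $i_k=i_{k+1}$. $\sigma_j\sigma_k=\sigma_k\sigma_j$ for $|j-k|>1$. $(\sigma_{k+1}\sigma_k\sigma_{k+1}-\sigma_k\sigma_{k+1}\sigma_k)\mathbf{e}(\mathbf{i})$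 equals, when $i_k=i_{k+2}$: $\mathbf{e}(\mathbf{i})$ if $i_k\to i_{k+1}$; $-\mathbf{e}(\mathbf{i})$ if $i_k\leftarrow i_{k+1}$; $(2x_{k+1}-x_{k+2}-x_k)\mathbf{e}(\mathbf{i})$ if $i_k\leftrightarrow i_{k+1}$; and $0$ in all other cases. (4) $(\sigma_kx_l-x_{s_k(l)}\sigma_k)\mathbf{e}(\mathbf{i})$ equals $-\mathbf{e}(\mathbf{i})$ if $l=k$, $i_k=i_{k+1}$; $\mathbf{e}(\mathbf{i})$ if $l=k+1$, $i_k=i_{k+1}$; $0$ otherwise. $\mathbf{R}_0=\mathbf{k}$. **VV algebra.** For $\nu\in{}^\theta\mathbb{N}I$ with $|\nu|=2m$, $\mathfrak{W}_\nu$ is the graded $\mathbf{k}$-algebra generated by $x_1,\dots,x_m$, $\sigma_1,\dots,\sigma_{m-1}$, $\pi$, and $\mathbf{e}(\mathbf{i})$, $\mathbf{i}\in{}^\theta I^\nu$, with relations (1)–(4) (now for $\mathbf{i}\in{}^\theta I^\nu$) together with: (5) $\pi\mathbf{e}(i_1,\dots,i_m)=\mathbf{e}(i_1^{-1},i_2,\dots,i_m)\pi$. (6) $\pi^2\mathbf{e}(\mathbf{i})$ equals $x_1\mathbf{e}(\mathbf{i})$ if $i_1=q$; $-x_1\mathbf{e}(\mathbf{i})$ if $i_1=q^{-1}$; $\mathbf{e}(\mathbf{i})$ otherwise. (7) $\pi x_1=-x_1\pi$; $\pi x_l=x_l\pi$ for $l>1$. (8) $(\sigma_1\pi)^2\mathbf{e}(\mathbf{i})-(\pi\sigma_1)^2\mathbf{e}(\mathbf{i})$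 equals $\sigma_1\mathbf{e}(\mathbf{i})$ if $i_1^{-1}=i_2=q^{-1}$; $-\sigma_1\mathbf{e}(\mathbf{i})$ if $i_1^{-1}=i_2=q$; $0$ otherwise. $\pi\sigma_k=\sigma_k\pi$ for $k\ne1$. $\mathfrak{W}_0=\mathbf{k}$. An idempotent subalgebra of an algebra $W$ is one of the form $\mathbf{e}W\mathbf{e}$ with $\mathbf{e}$ idempotent. *)

(* Defs.v *)
From HB Require Import structures.
From mathcomp Require Import all_boot all_order all_algebra perm.
From mathcomp Require Import finmap multiset monalg.
From mathcomp Require Import boolp.

Set Implicit Arguments.
Unset Strict Implicit.
Unset Printing Implicit Defensive.

Import GRing.Theory.
Local Open Scope ring_scope.
Local Open Scope quotient_scope.

Lemma malg_commC (K : fieldType) (M : monomType) (c : K) (a : {malg K[M]}) :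
  a * c%:MP = c *: a.
Proof.
apply: (etrans (fgmulgU c mone a)); apply: eq_bigr => i _.
by rewrite mulm1 mulrC.
Qed.

Lemma malg_scaleAr (K : fieldType) (M : monomType) (c : K)
  (a b : {malg K[M]}) : c *: (a * b) = a * (c *: b).
Proof. by rewrite -[c *: b]mul_malgC mulrA malg_commC scalerAl. Qed.

Section FreeAlgebra.

Variables (K : fieldType) (G : choiceType).

Definition freealg : Type := {malg K[{fmonom G}]}.

HB.instance Definition _ := GRing.Lalgebra.on freealg.

HB.instance Definition _ :=
  GRing.Lalgebra_isAlgebra.Build K freealg
  (@malg_scaleAr K {fmonom G}).

Definition freegen (g : G) : freealg := << fmu g >>.

End FreeAlgebra.

(* The quotient of the algebra F by the relations a = b for rel a b. *)
Section Presentation.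

Variables (K : fieldType) (F : algType K) (rel : F -> F -> Prop).

(* The two-sided ideal generated by the a - b with rel a b. *)
Inductive in_ideal : F -> Prop :=
| in_ideal_rel a b : rel a b -> in_ideal (a - b)
| in_ideal0 : in_ideal 0
| in_idealD a b : in_ideal a -> in_ideal b -> in_ideal (a + b)
| in_idealMl u a : in_ideal a -> in_ideal (u * a)
| in_idealMr u a : in_ideal a -> in_ideal (a * u).

Definition ideal_pred : {pred F} := fun a => `[< in_ideal a >].

Lemma ideal_predP a : reflect (in_ideal a) (a \in ideal_pred).
Proof. exact: asboolP. Qed.

Fact ideal_pred_zmod : zmod_closed ideal_pred.
Proof.
split; first by apply/ideal_predP; exact: in_ideal0.
move=> a b /ideal_predP ha /ideal_predP hb; apply/ideal_predP.
by rewrite -mulN1r; apply: in_idealD => //; exact: in_idealMl.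
Qed.

HB.instance Definition _ :=
  GRing.isZmodClosed.Build F ideal_pred ideal_pred_zmod.

Definition presented : Type := {ideal_quot ideal_pred}.

HB.instance Definition _ := GRing.Zmodule.on presented.

Definition pres_proj (a : F) : presented := \pi_{ideal_quot ideal_pred} a.

Lemma pres_projP a b : pres_proj a = pres_proj b <-> in_ideal (a - b).
Proof.
rewrite /pres_proj; split=> [/eqP|h].
  by rewrite -Quotient.idealrBE => /ideal_predP.
by apply/eqP; rewrite -Quotient.idealrBE; apply/ideal_predP.
Qed.

Lemma pres_projD : {morph pres_proj : a b / a + b}.
Proof. exact: Quotient.pi_add. Qed.

Let rep (x : presented) : F := repr (x : {ideal_quot ideal_pred}).

Let repK x : pres_proj (rep x) = x.
Proof. exact: reprK. Qed.

Let rep_ideal a : in_ideal (rep (pres_proj a) - a).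
Proof. by apply/pres_projP; rewrite repK. Qed.

Fact pres_key : unit. Proof. exact: tt. Qed.
Definition pres_one : presented := pres_proj 1.
Definition pres_mul : presented -> presented -> presented :=
  locked_with pres_key (fun x y => pres_proj (rep x * rep y)).
Definition pres_scale : K -> presented -> presented :=
  locked_with pres_key (fun c x => pres_proj (c *: rep x)).

Lemma in_idealZ c a : in_ideal a -> in_ideal (c *: a).
Proof. by rewrite -mulr_algl; exact: in_idealMl. Qed.

Lemma pres_projM a b : pres_proj (a * b) = pres_mul (pres_proj a) (pres_proj b).
Proof.
rewrite /pres_mul unlock; apply/esym/pres_projP.
rewrite -(subrKA (a * rep (pres_proj b))) -mulrBl -mulrBr.
by apply: in_idealD; [exact: in_idealMr | exact: in_idealMl].
Qed.

Lemma pres_projZ c a : pres_proj (c *: a) = pres_scale c (pres_proj a).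
Proof.
rewrite /pres_scale unlock; apply/esym/pres_projP.
by rewrite -scalerBr; exact: in_idealZ.
Qed.

Fact pres_mulA : associative pres_mul.
Proof.
by move=> x y z; rewrite -[x]repK -[y]repK -[z]repK -!pres_projM mulrA.
Qed.
Fact pres_mul1 : left_id pres_one pres_mul.
Proof. by move=> x; rewrite -[x]repK -pres_projM mul1r. Qed.
Fact pres_mulr1 : right_id pres_one pres_mul.
Proof. by move=> x; rewrite -[x]repK -pres_projM mulr1. Qed.
Fact pres_mulDl : left_distributive pres_mul +%R.
Proof.
move=> x y z; rewrite -[x]repK -[y]repK -[z]repK.
by rewrite -pres_projD -!pres_projM -pres_projD mulrDl.
Qed.
Fact pres_mulDr : right_distributive pres_mul +%R.
Proof.
move=> x y z; rewrite -[x]repK -[y]repK -[z]repK.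
by rewrite -pres_projD -!pres_projM -pres_projD mulrDr.
Qed.

HB.instance Definition _ := GRing.Zmodule_isPzRing.Build presented
  pres_mulA pres_mul1 pres_mulr1 pres_mulDl pres_mulDr.

Fact pres_scaleA a b v : pres_scale a (pres_scale b v) = pres_scale (a * b) v.
Proof. by rewrite -[v]repK -!pres_projZ scalerA. Qed.
Fact pres_scale1 : left_id 1 pres_scale.
Proof. by move=> x; rewrite -[x]repK -pres_projZ scale1r. Qed.
Fact pres_scaleDr : right_distributive pres_scale +%R.
Proof.
move=> c x y; rewrite -[x]repK -[y]repK.
by rewrite -pres_projD -!pres_projZ -pres_projD scalerDr.
Qed.
Fact pres_scaleDl v : {morph pres_scale^~ v : a b / a + b}.
Proof.
by move=> a b; rewrite /= -[v]repK -!pres_projZ -pres_projD scalerDl.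
Qed.

HB.instance Definition _ := GRing.Zmodule_isLmodule.Build K presented
  pres_scaleA pres_scale1 pres_scaleDr pres_scaleDl.

Fact pres_scaleAl (a : K) (x y : presented) : a *: (x * y) = (a *: x) * y.
Proof.
change (pres_scale a (pres_mul x y) = pres_mul (pres_scale a x) y).
rewrite -[x]repK -[y]repK -pres_projM -!pres_projZ -pres_projM.
by rewrite scalerAl.
Qed.
Fact pres_scaleAr (a : K) (x y : presented) : a *: (x * y) = x * (a *: y).
Proof.
change (pres_scale a (pres_mul x y) = pres_mul x (pres_scale a y)).
rewrite -[x]repK -[y]repK -pres_projM -!pres_projZ -pres_projM.
by rewrite scalerAr.
Qed.

End Presentation.

Record idempotent_of (A : pzRingType) :=
  IdempotentOf { idem : A; idemP : idem * idem = idem }.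

(* The idempotent subalgebra e W e, with unit e. *)
Section Corner.

Variables (K : fieldType) (F : algType K).
Variable rel : F -> F -> Prop.
Local Notation W := (presented rel).

Variable e : idempotent_of W.
Local Notation "'e" := (idem e).

(* As e is idempotent, y lies in e W e iff e y e = y. *)
Definition in_corner : {pred W} := fun y => 'e * y * 'e == y.

Lemma in_cornerP y : reflect (exists w, y = 'e * w * 'e) (y \in in_corner).
Proof.
apply: (iffP eqP) => [<-|[w ->]]; first by exists y.
by rewrite !mulrA idemP -!mulrA idemP.
Qed.

Record corner := Corner { corner_val : W; corner_valP : corner_val \in in_corner }.

HB.instance Definition _ := [isSub for corner_val].
HB.instance Definition _ := [Choice of corner by <:].

Fact corner_submod : submod_closed in_corner.
Proof.
split=> [|a x y /in_cornerP[u ->] /in_cornerP[v ->]]; apply/in_cornerP.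
  by exists 0; rewrite mulr0 mul0r.
by exists (a *: u + v); rewrite mulrDr mulrDl -pres_scaleAr -pres_scaleAl.
Qed.

HB.instance Definition _ :=
  GRing.isSubmodClosed.Build K W in_corner corner_submod.
HB.instance Definition _ := [SubChoice_isSubLmodule of corner by <:].

Fact corner_in1 : 'e \in in_corner.
Proof. by apply/in_cornerP; exists 1; rewrite mulr1 idemP. Qed.
Fact corner_inM (x y : corner) : val x * val y \in in_corner.
Proof.
have /in_cornerP[u ->] := valP x; have /in_cornerP[v ->] := valP y.
by apply/in_cornerP; exists (u * 'e * ('e * v)); rewrite !mulrA.
Qed.
Fact corner_absl (x : corner) : 'e * val x = val x.
Proof. by have /in_cornerP[u ->] := valP x; rewrite !mulrA idemP. Qed.
Fact corner_absr (x : corner) : val x * 'e = val x.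
Proof. by have /in_cornerP[u ->] := valP x; rewrite -!mulrA idemP. Qed.

Definition corner_one : corner := Corner corner_in1.
Definition corner_mul (x y : corner) : corner := Corner (corner_inM x y).

Fact corner_mulA : associative corner_mul.
Proof. by move=> x y z; apply/val_inj; rewrite /= mulrA. Qed.
Fact corner_mul1 : left_id corner_one corner_mul.
Proof. by move=> x; apply/val_inj; exact: corner_absl. Qed.
Fact corner_mulr1 : right_id corner_one corner_mul.
Proof. by move=> x; apply/val_inj; exact: corner_absr. Qed.
Fact corner_mulDl : left_distributive corner_mul +%R.
Proof. by move=> x y z; apply/val_inj; rewrite /= mulrDl. Qed.
Fact corner_mulDr : right_distributive corner_mul +%R.
Proof. by move=> x y z; apply/val_inj; rewrite /= mulrDr. Qed.

HB.instance Definition _ := GRing.Zmodule_isPzRing.Build corner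
  corner_mulA corner_mul1 corner_mulr1 corner_mulDl corner_mulDr.

Fact corner_scaleAl (a : K) (x y : corner) : a *: (x * y) = (a *: x) * y.
Proof. by apply/val_inj; rewrite /= pres_scaleAl. Qed.
Fact corner_scaleAr (a : K) (x y : corner) : a *: (x * y) = x * (a *: y).
Proof. by apply/val_inj; rewrite /= pres_scaleAr. Qed.

End Corner.

(* The subtype of m-tuples of elements of I whose weight is nu is finite. *)
Section Words.

Variables (I : choiceType) (m : nat) (wt : m.-tuple I -> {mset I}%mset).
Variable (nu : {mset I}%mset).
Hypothesis wt_supp : forall i x, x \in tval i -> (0 < wt i x)%N.

Let all_words : seq (m.-tuple I) :=
  [seq map_tuple val t | t : m.-tuple (finsupp nu)].

Let all_wordsP (i : m.-tuple I) : wt i == nu -> i \in all_words.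
Proof.
move=> /eqP hi.
have hs x : x \in tval i -> x \in finsupp nu.
  by move=> /wt_supp; rewrite hi mem_finsupp lt0n.
apply/imageP; exists [tuple FSetSub (hs _ (mem_tnth l i)) | l < m] => //.
by apply: eq_from_tnth => l; rewrite tnth_map tnth_mktuple.
Qed.

Local Notation T := {i : m.-tuple I | wt i == nu}.
Definition enum_words : seq T := undup (pmap insub all_words).

Let enum_words_mem (i : T) : i \in enum_words.
Proof.
by rewrite mem_undup mem_pmap_sub; apply: all_wordsP; exact: (valP i).
Qed.

Fact words_pcan : pcancel (index^~ enum_words) (onth enum_words).
Proof. by move=> i; rewrite onthE (nth_map i) ?nth_index ?index_mem. Qed.

Fact words_enumP : Finite.axiom enum_words.
Proof. by apply: Finite.uniq_enumP; [exact: undup_uniq | exact: enum_words_mem]. Qed.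

End Words.

Section Orbit.

Variables (K : fieldType) (p lam : K).

(* (n, eps) . x = p^(2n) x^eps, where eps = -1 is encoded by true. *)
Definition Iact (g : int * bool) (x : K) : K :=
  p ^ (2 * g.1) * (if g.2 then x^-1 else x).

Definition in_Iorb : {pred K} := fun x => `[< exists g, x = Iact g lam >].

Lemma in_IorbP x : reflect (exists g, x = Iact g lam) (x \in in_Iorb).
Proof. exact: asboolP. Qed.

Record Iorb := IOrb { Iorb_val :> K; Iorb_valP : Iorb_val \in in_Iorb }.

HB.instance Definition _ := [isSub for Iorb_val].
HB.instance Definition _ := [Choice of Iorb by <:].

Fact Iinv_subproof (i : Iorb) : (i : K)^-1 \in in_Iorb.
Proof.
case: i => i /= /in_IorbP[[n b] ->]; apply/in_IorbP; exists (- n, ~~ b).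
by rewrite /Iact /= invfM mulrN invr_expz; case: b; rewrite ?invrK.
Qed.

Definition Iinv (i : Iorb) : Iorb := IOrb (Iinv_subproof i).

(* The quiver: one quiver_arrow p^2 i -> i for every i, so at most one between any   *)
(* two vertices.                                                              *)
Definition quiver_arrow (i j : Iorb) : bool := (i : K) == p ^+ 2 * (j : K).

Definition arrow_to (i j : Iorb) := quiver_arrow i j && ~~ quiver_arrow j i.
Definition arrow_both (i j : Iorb) := quiver_arrow i j && quiver_arrow j i.


(* Formal sums over I with coefficients in N are multisets. *)
Definition in_thetaNI (nu : {mset Iorb}%mset) : Prop :=
  forall i, nu i = nu (Iinv i).

Definition mset_inv (nu : {mset Iorb}%mset) : {mset Iorb}%mset :=
  seq_mset [seq Iinv i | i <- nu].

Definition klr_weight m (i : m.-tuple Iorb) : {mset Iorb}%mset := seq_mset i.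
Definition vv_weight m (i : m.-tuple Iorb) : {mset Iorb}%mset :=
  (seq_mset i `+` seq_mset (map Iinv i))%mset.

Fact klr_weight_supp m (i : m.-tuple Iorb) x :
  x \in tval i -> (0 < klr_weight i x)%N.
Proof. by rewrite mset_seqE -has_count has_pred1. Qed.

Fact vv_weight_supp m (i : m.-tuple Iorb) x :
  x \in tval i -> (0 < vv_weight i x)%N.
Proof. by move=> hx; rewrite msetE2 addn_gt0 klr_weight_supp. Qed.

Definition klr_word m (nu : {mset Iorb}%mset) : Type :=
  {i : m.-tuple Iorb | klr_weight i == nu}.
Definition vv_word m (nu : {mset Iorb}%mset) : Type :=
  {i : m.-tuple Iorb | vv_weight i == nu}.

HB.instance Definition _ m nu := Choice.on (klr_word m nu).
HB.instance Definition _ m nu :=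
  @PCanIsCountable nat (klr_word m nu) _ _
    (words_pcan (nu := nu) (@klr_weight_supp m)).
HB.instance Definition _ m nu := isFinite.Build (klr_word m nu)
  (words_enumP (nu := nu) (@klr_weight_supp m)).

HB.instance Definition _ m nu := Choice.on (vv_word m nu).
HB.instance Definition _ m nu :=
  @PCanIsCountable nat (vv_word m nu) _ _
    (words_pcan (nu := nu) (@vv_weight_supp m)).
HB.instance Definition _ m nu := isFinite.Build (vv_word m nu)
  (words_enumP (nu := nu) (@vv_weight_supp m)).

End Orbit.

(* Positions are numbered from 0: sigma_k acts on the positions lo k = k and  *)
(* hi k = k + 1, for k < m - 1.                                               *)
Section Positions.

Variable m : nat.

Definition lo (k : 'I_m.-1) : 'I_m := widen_ord (leq_pred m) k.

Fact hi_subproof (k : 'I_m.-1) : (k.+1 < m)%N.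
Proof. by rewrite -ltn_predRL. Qed.

Definition hi (k : 'I_m.-1) : 'I_m := Ordinal (hi_subproof k).

Definition swap_word (T : Type) (k : 'I_m.-1) (i : m.-tuple T) : m.-tuple T :=
  [tuple tnth i (tperm (lo k) (hi k) l) | l < m].

End Positions.

(* Relations between elements x, s, e of a ring A, where e is indexed by a    *)
(* finite type T of words and w gives the entries of a word.                  *)
Section KLRRelations.

Variables (K : fieldType) (p lam : K) (m : nat).
Variables (T : finType) (w : T -> m.-tuple (Iorb p lam)).
Variables (A : pzRingType) (x : 'I_m -> A) (s : 'I_m.-1 -> A) (e : T -> A).

Definition quad_coef (k : 'I_m.-1) (i : T) : A :=
  let a := tnth (w i) (lo k) in
  let b := tnth (w i) (hi k) in
  if a == b then 0
  else if arrow_both a b then (x (hi k) - x (lo k)) * (x (lo k) - x (hi k))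
  else if arrow_to a b then x (lo k) - x (hi k)
  else if arrow_to b a then x (hi k) - x (lo k)
  else 1.

(* The three positions involved are lo k, hi k and hi k', where k' = k + 1. *)
Definition braid_coef (k k' : 'I_m.-1) (i : T) : A :=
  let a := tnth (w i) (lo k) in
  let b := tnth (w i) (hi k) in
  let c := tnth (w i) (hi k') in
  if a != c then 0
  else if arrow_both a b then x (hi k) *+ 2 - x (hi k') - x (lo k)
  else if arrow_to a b then 1
  else if arrow_to b a then -1
  else 0.

Definition demazure_coef (k : 'I_m.-1) (l : 'I_m) (i : T) : A :=
  if tnth (w i) (lo k) != tnth (w i) (hi k) then 0
  else if l == lo k then -1
  else if l == hi k then 1
  else 0.

Inductive klr_rel : A -> A -> Prop :=
| klr_ee i j :
    klr_rel (e i * e j) (if i == j then e i else 0)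
| klr_se k i j : w j = swap_word k (w i) ->
    klr_rel (s k * e i) (e j * s k)
| klr_xe l i :
    klr_rel (x l * e i) (e i * x l)
| klr_sum :
    klr_rel (\sum_i e i) 1
| klr_xx l l' :
    klr_rel (x l * x l') (x l' * x l)
| klr_quad k i :
    klr_rel (s k ^+ 2 * e i) (quad_coef k i * e i)
| klr_ss (j k : 'I_m.-1) : (j.+1 < k)%N || (k.+1 < j)%N ->
    klr_rel (s j * s k) (s k * s j)
| klr_braid (k k' : 'I_m.-1) i : k' = k.+1 :> nat ->
    klr_rel ((s k' * s k * s k' - s k * s k' * s k) * e i)
            (braid_coef k k' i * e i)
| klr_sx k l i :
    klr_rel ((s k * x l - x (tperm (lo k) (hi k) l) * s k) * e i)
            (demazure_coef k l i * e i).

End KLRRelations.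

(* The generator pi, like the entry i_1, exists only when m > 0, so that the  *)
(* algebra for m = 0 is K.                                                    *)
Section VVRelations.

Variables (K : fieldType) (p q lam : K) (m : nat).
Variables (T : finType) (w : T -> m.-tuple (Iorb p lam)).
Variables (A : pzRingType) (x : 'I_m -> A) (s : 'I_m.-1 -> A).
Variables (pi : (0 < m)%N -> A) (e : T -> A).

Definition flip_word (i : m.-tuple (Iorb p lam)) : m.-tuple (Iorb p lam) :=
  [tuple if l == 0%N :> nat then Iinv (tnth i l) else tnth i l | l < m].

Definition pi_quad_coef (h : (0 < m)%N) (i : T) : A :=
  let x1 := x (Ordinal h) in
  let a : K := Iorb_val (tnth (w i) (Ordinal h)) in
  if a == q then x1 else if a == q^-1 then - x1 else 1.

(* k is the index of sigma_1, so lo k and hi k are the first two positions. *)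
Definition pi_braid_term (k : 'I_m.-1) (i : T) : A :=
  let a : K := Iorb_val (tnth (w i) (lo k)) in
  let b : K := Iorb_val (tnth (w i) (hi k)) in
  if (a^-1 == b) && (b == q^-1) then s k * e i
  else if (a^-1 == b) && (b == q) then - (s k * e i)
  else 0.

Inductive vv_rel : A -> A -> Prop :=
| vv_klr a b : klr_rel w x s e a b ->
    vv_rel a b
| vv_pe h i j : w j = flip_word (w i) ->
    vv_rel (pi h * e i) (e j * pi h)
| vv_quad h i :
    vv_rel (pi h ^+ 2 * e i) (pi_quad_coef h i * e i)
| vv_px h l :
    vv_rel (pi h * x l) (if l == 0%N :> nat then - (x l * pi h) else x l * pi h)
| vv_braid h (k : 'I_m.-1) i : k = 0%N :> nat ->
    vv_rel (((s k * pi h) ^+ 2 - (pi h * s k) ^+ 2) * e i) (pi_braid_term k i)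
| vv_ps h (k : 'I_m.-1) : k != 0%N :> nat ->
    vv_rel (pi h * s k) (s k * pi h).

End VVRelations.

Section Algebras.

Variables (K : fieldType) (p q lam : K) (m : nat).
Variable nu : {mset Iorb p lam}%mset.

Inductive klr_gen : Type :=
| KlrX of 'I_m
| KlrS of 'I_m.-1
| KlrE of klr_word m nu.

Inductive vv_gen : Type :=
| VvX of 'I_m
| VvS of 'I_m.-1
| VvPi of (0 < m)%N
| VvE of vv_word m nu.

HB.instance Definition _ := gen_eqMixin klr_gen.
HB.instance Definition _ := gen_choiceMixin klr_gen.
HB.instance Definition _ := gen_eqMixin vv_gen.
HB.instance Definition _ := gen_choiceMixin vv_gen.

(* R_nu, to be used with |nu| = m. *)
Definition klr_algebra :=
  presented (@klr_rel K p lam m (klr_word m nu) val (freealg K klr_gen)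
    (fun l => freegen K (KlrX l)) (fun k => freegen K (KlrS k))
    (fun i => freegen K (KlrE i))).

(* W_nu, to be used with nu in thetaNI and |nu| = 2m. *)
Definition vv_algebra :=
  presented (@vv_rel K p q lam m (vv_word m nu) val (freealg K vv_gen)
    (fun l => freegen K (VvX l)) (fun k => freegen K (VvS k))
    (fun h => freegen K (VvPi h)) (fun i => freegen K (VvE i))).

End Algebras.

(* Main.v *)
Require Import Defs.
From HB Require Import structures.
From mathcomp Require Import all_boot all_order all_algebra perm.
From mathcomp Require Import finmap multiset monalg.
From mathcomp Require Import boolp zify.

Set Implicit Arguments.
Unset Strict Implicit.
Unset Printing Implicit Defensive.

Import GRing.Theory.
Local Open Scope ring_scope.

(** The idempotent is e = sum of e(j) over the words j of the multiset nut, seen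
as words of nu. Sending the generators of R to the elements x_l e, sigma_k e and
e(j) of e W e respects the relations of R, so there is an algebra morphism h from
R to e W e, and the theorem says that h is bijective.

Since nut never contains both i and its inverse, exactly one of i and its inverse
is a letter of nut whenever one of them is a letter of a word of nu. Hence a word
of nu comes from a word j of nut by permuting letters and inverting some of them.
Record the positions of the inverted letters in a sign pattern eps. For a fixed
eps the positions of the word and those of j are matched by one permutation,
strand_rank: read the inverted letters from right to left, then the others from
left to right. The sign patterns thus index the minimal representatives of the
cosets of the symmetric group in the hyperoctahedral group, and the W-module
W e should be free over R with one basis vector for every eps.

Injectivity of h (vv_matrices). This module is written down explicitly. The matrices
over R with rows and columns indexed by sign patterns carry an action of W: x_l
becomes plus or minus the variable of R that belongs to position l; a sigma_k
between two letters of the same sign becomes the corresponding sigma of R; a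
sigma_k between letters of opposite signs and pi only move the sign pattern. Of
the two mutually inverse moves between a pair of patterns, one gets the
coefficient 1 and the other the full polynomial that the relations prescribe for
sigma_k^2 or pi^2. Letters of opposite signs are distinct, so this is consistent.
The relations of W then reduce to those of R; the correction terms of the braid
relations that mix signs come out as divided differences of those polynomials
(demazure_quad_poly, demazure_pi_poly). The entry of a matrix at the
all-positive pattern is a left inverse f of h.

Surjectivity of h (transport_sigma, transport_pi, transport_x, transport_e). For
every eps take in W e the product T_eps of the generators along a path of moves
from the all-positive pattern to eps; the path does not matter because two
different last moves commute. Generators of W slide through T_eps, leaving on the
right the very coefficients of the matrices above. So w e is the sum over eps of
T_eps h(r_eps), where r_eps runs over the all-positive column of the matrix of w.
Multiplying by e on the left kills every term but that of the all-positive
pattern, whence e w e = h(f(e w e)). *)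

(** * Maps out of presented algebras *)

Section FreeLift.

Variables (K : fieldType) (G : choiceType) (A : pzRingType).
Variables (kap : {rmorphism K -> A}) (gam : G -> A).
Hypothesis kapC : forall c a, kap c * a = a * kap c.

(** The scalars act through a ring morphism kap into the centre of A, rather than
through a module structure, so that A can be a ring of matrices over R, whose
module structure is over R and not over the ground field. *)
Definition free_eval (a : freealg K G) : A :=
  \sum_(k <- msupp a) kap a@_k * \prod_(g <- (k : seq G)) gam g.

Lemma free_evalEw (d : {fset {fmonom G}}) (a : freealg K G) : (msupp a `<=` d)%fset ->
  free_eval a = \sum_(k <- d) kap a@_k * \prod_(g <- (k : seq G)) gam g.
Proof.
move=> le; rewrite [LHS](big_fset_incl _ le) => //= x xd /mcoeff_outdom ->.
by rewrite rmorph0 mul0r.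
Qed.

Lemma free_evalU (c : K) (k : {fmonom G}) :
  free_eval << c *g k >> = kap c * \prod_(g <- (k : seq G)) gam g.
Proof. by rewrite (free_evalEw msuppU_le) big_seq_fset1 mcoeffUU. Qed.

Fact free_eval_zmod : zmod_morphism free_eval.
Proof.
move=> g1 g2; pose d := (msupp g1 `|` msupp g2 `|` msupp (g1 - g2))%fset.
rewrite 3?(free_evalEw (d := d)) /d ?fsubsetUr //.
- by rewrite -sumrB; apply/eq_bigr=> k _; rewrite !raddfB /= mulrBl.
- by rewrite -fsetUA fsetUCA fsubsetUl.
- by rewrite -fsetUA fsubsetUl.
Qed.

HB.instance Definition _ :=
  GRing.isZmodMorphism.Build (freealg K G) A free_eval free_eval_zmod.

Fact free_eval_monoid : monoid_morphism free_eval.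
Proof.
split; first by rewrite [1]/(<< 1 *g mone >>) free_evalU rmorph1 mul1r fm1 big_nil.
move=> a b; rewrite [a * b](malgME a b) raddf_sum /= mulr_suml.
apply: eq_bigr => i _; rewrite raddf_sum /= mulr_sumr.
apply: eq_bigr => j _; rewrite free_evalU rmorphM fmM big_cat /=.
by rewrite -!mulrA; congr (_ * _); rewrite mulrA kapC !mulrA.
Qed.

Lemma free_eval_gen g : free_eval (freegen K g) = gam g.
Proof. by rewrite /freegen free_evalU rmorph1 mul1r fmU big_seq1. Qed.

Lemma free_evalZ c a : free_eval (c *: a) = kap c * free_eval a.
Proof.
rewrite (_ : c *: a = (<< c *g (mone : {fmonom G}) >> : freealg K G) * a);
  last exact/esym/mul_malgC.
by rewrite free_eval_monoid.2 free_evalU fm1 big_nil mulr1.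
Qed.

End FreeLift.

Lemma freealg_ind (K : fieldType) (G : choiceType) (P : freealg K G -> Prop) :
  P 1 -> (forall a b, P a -> P b -> P (a + b)) -> (forall c a, P a -> P (c *: a)) ->
  (forall g a, P a -> P (freegen K g * a)) -> forall a, P a.
Proof.
move=> P1 PD PZ PM a; rewrite [a]monalgE; elim/big_ind: _ => //.
  by rewrite -(scale0r (1 : freealg K G)); exact: PZ.
move=> k _; rewrite (_ : << _ *g k >> = a@_k *: (<< k >> : freealg K G)); last first.
  rewrite -[RHS]mul_malgC; apply/esym/(etrans (fgmulUU _ _ _ _)).
  by rewrite mulr1 mul1m.
apply: PZ; case: k => s; elim: s => [|g s IH].
  by rewrite (_ : FMonom [::] = mone) //; apply/val_inj; rewrite /= fm1.
rewrite (_ : << _ >> = freegen K g * (<< FMonom s >> : freealg K G)); first exact: PM.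
apply/esym/(etrans (fgmulUU _ _ _ _)); rewrite mulr1; congr mkmalgU.
by apply/val_inj; rewrite /= fmM fmU.
Qed.

Section PresentedProjection.

Variables (K : fieldType) (F : algType K) (rel : F -> F -> Prop).
Local Notation W := (presented rel).

Fact pres_proj_zmod : zmod_morphism (@pres_proj _ _ rel).
Proof.
move=> a b; apply: (addIr (pres_proj rel b)).
by rewrite subrK -pres_projD subrK.
Qed.
HB.instance Definition _ :=
  GRing.isZmodMorphism.Build F W (@pres_proj _ _ rel) pres_proj_zmod.

Fact pres_proj_monoid : monoid_morphism (@pres_proj _ _ rel).
Proof. by split=> // a b; exact: pres_projM. Qed.
HB.instance Definition _ :=
  GRing.isMonoidMorphism.Build F W (@pres_proj _ _ rel) pres_proj_monoid.

Lemma pres_proj_surj (y : W) : exists a, y = pres_proj rel a.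
Proof.
by exists (repr (y : {ideal_quot (ideal_pred rel)})%type); exact/esym/reprK.
Qed.

Lemma pres_proj_rel a b : rel a b -> pres_proj rel a = pres_proj rel b.
Proof. by move=> h; apply/pres_projP; exact: in_ideal_rel. Qed.

Variables (A : pzRingType) (phi : {rmorphism F -> A}).
Hypothesis rel_phi : forall a b, rel a b -> phi a = phi b.

Lemma presented_factor :
  exists f : {rmorphism W -> A}, forall a, f (pres_proj rel a) = phi a.
Proof.
pose f (y : W) := phi (repr (y : {ideal_quot (ideal_pred rel)})%type).
have ker a : in_ideal rel a -> phi a = 0.
  elim=> [b c /rel_phi h| |b c _ hb _ hc|u b _ hb|u b _ hb].
  - by rewrite rmorphB h subrr.
  - by rewrite rmorph0.
  - by rewrite rmorphD hb hc addr0.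
  - by rewrite rmorphM hb mulr0.
  - by rewrite rmorphM hb mul0r.
have projE a : f (pres_proj rel a) = phi a.
  apply/eqP; rewrite -subr_eq0 -rmorphB; apply/eqP/ker/pres_projP; exact: reprK.
have fB : zmod_morphism f.
  move=> y z; have [a ->] := pres_proj_surj y; have [b ->] := pres_proj_surj z.
  by rewrite -rmorphB !projE rmorphB.
have fM : monoid_morphism f.
  split; first by rewrite -(rmorph1 (pres_proj rel)) projE rmorph1.
  move=> y z; have [a ->] := pres_proj_surj y; have [b ->] := pres_proj_surj z.
  by rewrite -rmorphM !projE rmorphM.
exists (HB.pack_for {rmorphism W -> A} f
  (GRing.isZmodMorphism.Build _ _ f fB) (GRing.isMonoidMorphism.Build _ _ f fM)).
exact: projE.
Qed.

End PresentedProjection.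

Section PresentedLift.

Variables (K : fieldType) (G : choiceType).
Variable rel : freealg K G -> freealg K G -> Prop.
Local Notation W := (presented rel).

Definition pres_gen (g : G) : W := pres_proj rel (freegen K g).

(** Left multiplication by one generator at a time is enough, because a monomial
of the free algebra is a list of generators. *)
Lemma presented_ind (P : W -> Prop) :
  P 1 -> (forall a b, P a -> P b -> P (a + b)) -> (forall c a, P a -> P (c *: a)) ->
  (forall g a, P a -> P (pres_gen g * a)) -> forall a, P a.
Proof.
move=> P1 PD PZ PM y; have [a ->] := pres_proj_surj y.
elim/freealg_ind: a => [//|a b|c a|g a].
- by rewrite pres_projD; exact: PD.
- by rewrite pres_projZ; exact: PZ.
- by rewrite pres_projM; exact: PM.
Qed.

Variables (A : pzRingType) (kap : {rmorphism K -> A}) (gam : G -> A).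
Hypothesis kapC : forall c a, kap c * a = a * kap c.
Variable phi : {rmorphism freealg K G -> A}.
Hypothesis phiE : phi =1 free_eval kap gam.
Hypothesis rel_phi : forall a b, rel a b -> phi a = phi b.

Lemma presented_lift : exists f : {rmorphism W -> A},
  (forall c y, f (c *: y) = kap c * f y) /\ (forall g, f (pres_gen g) = gam g).
Proof.
have [f fE] := presented_factor rel_phi; exists f; split=> [c y|g].
  have [a ->] := pres_proj_surj y.
  by rewrite -[c *: _](pres_projZ rel) !fE !phiE free_evalZ.
by rewrite fE phiE free_eval_gen.
Qed.

End PresentedLift.

Lemma free_eval_rmorphism (K : fieldType) (G : choiceType) (A : pzRingType)
    (kap : {rmorphism K -> A}) (gam : G -> A) :
  (forall c a, kap c * a = a * kap c) ->
  exists phi : {rmorphism freealg K G -> A}, phi =1 free_eval kap gam.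
Proof.
move=> kapC; exists (HB.pack_for {rmorphism freealg K G -> A} (free_eval kap gam)
   (GRing.isMonoidMorphism.Build _ _ _ (free_eval_monoid gam kapC))).
by [].
Qed.

(** * Families of elements satisfying the relations *)

Section Families.

Variables (K : fieldType) (p q lam : K) (m : nat).
Variables (T : finType) (w : T -> m.-tuple (Iorb p lam)).

Definition klr_family (A : pzRingType) (x : 'I_m -> A) (s : 'I_m.-1 -> A)
    (e : T -> A) :=
  forall a b, klr_rel w x s e a b -> a = b.

Definition vv_family (A : pzRingType) (x : 'I_m -> A) (s : 'I_m.-1 -> A)
    (pi : (0 < m)%N -> A) (e : T -> A) :=
  forall a b, vv_rel q w x s pi e a b -> a = b.

Variables (A B : pzRingType) (phi : {rmorphism A -> B}).
Variables (x : 'I_m -> A) (s : 'I_m.-1 -> A) (pi : (0 < m)%N -> A) (e : T -> A).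
Local Notation "f '^phi'" := (fun y => phi (f y)) (at level 2, format "f ^phi").

Lemma rmorph_quad_coef k i : phi (quad_coef w x k i) = quad_coef w x^phi k i.
Proof.
by rewrite /quad_coef; do !case: ifP => _;
  rewrite ?(rmorph0, rmorph1, rmorphB, rmorphM).
Qed.

Lemma rmorph_braid_coef k k' i :
  phi (braid_coef w x k k' i) = braid_coef w x^phi k k' i.
Proof.
by rewrite /braid_coef; do !case: ifP => _;
  rewrite ?(rmorph0, rmorphN1, rmorph1, rmorphB, rmorphMn).
Qed.

Lemma rmorph_demazure_coef k l i :
  phi (demazure_coef w A k l i) = demazure_coef w B k l i.
Proof.
by rewrite /demazure_coef; do !case: ifP => _; rewrite ?(rmorph0, rmorphN1, rmorph1).
Qed.

Lemma rmorph_pi_quad_coef h i :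
  phi (pi_quad_coef q w x h i) = pi_quad_coef q w x^phi h i.
Proof.
by rewrite /pi_quad_coef; do !case: ifP => _; rewrite ?(rmorphN, rmorph1).
Qed.

Lemma rmorph_pi_braid_term k i :
  phi (pi_braid_term q w s e k i) = pi_braid_term q w s^phi e^phi k i.
Proof.
by rewrite /pi_braid_term; do !case: ifP => _; rewrite ?(rmorph0, rmorphN, rmorphM).
Qed.

Definition rmorph_coef := (rmorph_quad_coef, rmorph_braid_coef,
  rmorph_demazure_coef, rmorph_pi_quad_coef, rmorph_pi_braid_term).

Lemma rmorph_klr_rel a b :
  klr_rel w x s e a b -> klr_rel w x^phi s^phi e^phi (phi a) (phi b).
Proof.
case=> [i j|k i j h|l i||l l'|k i|j k h|k k' i h|k l i];
  rewrite ?(rmorph_coef, rmorphM, rmorphB, rmorphXn, rmorph_sum, rmorph1) /=.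
- by rewrite (fun_if phi) rmorph0; exact: klr_ee.
- exact: klr_se.
- exact: klr_xe.
- exact: klr_sum.
- exact: klr_xx.
- exact: klr_quad.
- exact: klr_ss.
- exact: klr_braid.
- exact: klr_sx.
Qed.

Lemma rmorph_vv_rel a b :
  vv_rel q w x s pi e a b -> vv_rel q w x^phi s^phi pi^phi e^phi (phi a) (phi b).
Proof.
case=> [{}a {}b /rmorph_klr_rel|h i j ij|h i|h l|h k i k0|h k k0];
  rewrite ?(rmorph_coef, rmorphM, rmorphB, rmorphXn, rmorph_sum, rmorph1) /=.
- exact: vv_klr.
- exact: vv_pe.
- exact: vv_quad.
- by rewrite (fun_if phi) rmorphN rmorphM; exact: vv_px.
- exact: vv_braid.
- exact: vv_ps.
Qed.

(** A relation between images of elements is the image of a relation: this makes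
the generators of a presented algebra satisfy the defining relations. *)
Lemma klr_rel_rmorph a' b' : klr_rel w x^phi s^phi e^phi a' b' ->
  exists a b, [/\ klr_rel w x s e a b, a' = phi a & b' = phi b].
Proof.
case=> [i j|k i j h|l i||l l'|k i|j k h|k k' i h|k l i].
- by do 2!eexists; split; [exact: (klr_ee w x s e i j)| |];
    rewrite ?(fun_if phi) ?rmorph0 ?rmorphM.
- by do 2!eexists; split; [exact: (klr_se x s e h)| |]; rewrite rmorphM.
- by do 2!eexists; split; [exact: (klr_xe w x s e l i)| |]; rewrite rmorphM.
- by do 2!eexists; split; [exact: (klr_sum w x s e)| |];
    rewrite ?rmorph1 ?rmorph_sum.
- by do 2!eexists; split; [exact: (klr_xx w x s e l l')| |]; rewrite rmorphM.
- by do 2!eexists; split; [exact: (klr_quad w x s e k i)| |];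
    rewrite rmorphM ?rmorphXn ?rmorph_coef.
- by do 2!eexists; split; [exact: (klr_ss w x s e h)| |]; rewrite rmorphM.
- by do 2!eexists; split; [exact: (klr_braid w x s e i h)| |];
    rewrite rmorphM ?rmorphB ?rmorphM ?rmorph_coef.
- by do 2!eexists; split; [exact: (klr_sx w x s e k l i)| |];
    rewrite rmorphM ?rmorphB ?rmorphM ?rmorph_coef.
Qed.

Lemma vv_rel_rmorph a' b' : vv_rel q w x^phi s^phi pi^phi e^phi a' b' ->
  exists a b, [/\ vv_rel q w x s pi e a b, a' = phi a & b' = phi b].
Proof.
case=> [a b /klr_rel_rmorph[a0 [b0 [h -> ->]]]|h i j ij|h i|h l|h k i k0|h k k0].
- by exists a0, b0; split=> //; exact: vv_klr.
- by do 2!eexists; split; [exact: (vv_pe q x s pi e h ij)| |]; rewrite rmorphM.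
- by do 2!eexists; split; [exact: (vv_quad q w x s pi e h i)| |];
    rewrite rmorphM ?rmorphXn ?rmorph_coef.
- by do 2!eexists; split; [exact: (vv_px q w x s pi e h l)| |];
    rewrite ?(fun_if phi) ?rmorphN rmorphM.
- by do 2!eexists; split; [exact: (vv_braid q w x s pi e h i k0)| |];
    rewrite ?rmorph_coef // rmorphM rmorphB !rmorphXn !rmorphM.
- by do 2!eexists; split; [exact: (vv_ps q w x s pi e h k0)| |]; rewrite rmorphM.
Qed.

End Families.

Section Generators.

Variables (K : fieldType) (p q lam : K) (m : nat).
Variable nu : {mset Iorb p lam}%mset.

Local Notation R := (klr_algebra m nu).
Local Notation W := (vv_algebra q m nu).

Definition Rx (l : 'I_m) : R := pres_gen _ (KlrX nu l).
Definition Rs (k : 'I_m.-1) : R := pres_gen _ (KlrS nu k).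
Definition Re (j : klr_word m nu) : R := pres_gen _ (KlrE j).

Definition Wx (l : 'I_m) : W := pres_gen _ (VvX nu l).
Definition Ws (k : 'I_m.-1) : W := pres_gen _ (VvS nu k).
Definition Wpi (h : (0 < m)%N) : W := pres_gen _ (VvPi nu h).
Definition We (i : vv_word m nu) : W := pres_gen _ (VvE i).

Lemma klr_algebraP : klr_family (T := klr_word m nu) val Rx Rs Re.
Proof.
by move=> a b /klr_rel_rmorph[a0 [b0 [h -> ->]]]; exact: pres_proj_rel.
Qed.

Lemma vv_algebraP : vv_family q (T := vv_word m nu) val Wx Ws Wpi We.
Proof.
by move=> a b /vv_rel_rmorph[a0 [b0 [h -> ->]]]; exact: pres_proj_rel.
Qed.

Lemma klr_algebra_lift (A : pzRingType) (kap : {rmorphism K -> A}) 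
    (x : 'I_m -> A) (s : 'I_m.-1 -> A) (e : klr_word m nu -> A) :
  (forall c a, kap c * a = a * kap c) -> klr_family (T := klr_word m nu) val x s e ->
  exists f : {rmorphism R -> A}, (forall c y, f (c *: y) = kap c * f y) /\
    [/\ forall l, f (Rx l) = x l, forall k, f (Rs k) = s k & forall j, f (Re j) = e j].
Proof.
move=> kapC famA.
pose gam (g : klr_gen m nu) := match g with
  KlrX l => x l | KlrS k => s k | KlrE j => e j end.
have [phi phiE] := free_eval_rmorphism gam kapC.
have [a b h|f [fZ fE]] := presented_lift kapC phiE (rel := klr_rel
    (T := klr_word m nu) val
    (fun l => freegen K (KlrX nu l)) (fun k => freegen K (KlrS nu k))
    (fun i => freegen K (KlrE i))).
  apply: famA; have := rmorph_klr_rel phi h.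
  congr klr_rel; apply/funext => y; exact/(etrans (phiE _))/free_eval_gen.
exists f; split=> //.
by split=> y; rewrite fE.
Qed.

Lemma vv_algebra_lift (A : pzRingType) (kap : {rmorphism K -> A}) 
    (x : 'I_m -> A) (s : 'I_m.-1 -> A) pi (e : vv_word m nu -> A) :
  (forall c a, kap c * a = a * kap c) -> vv_family q (T := vv_word m nu) val x s pi e ->
  exists f : {rmorphism W -> A}, (forall c y, f (c *: y) = kap c * f y) /\
    [/\ forall l, f (Wx l) = x l, forall k, f (Ws k) = s k,
        forall h, f (Wpi h) = pi h & forall j, f (We j) = e j].
Proof.
move=> kapC famA.
pose gam (g : vv_gen m nu) := match g with
  VvX l => x l | VvS k => s k | VvPi h => pi h | VvE j => e j end.
have [phi phiE] := free_eval_rmorphism gam kapC.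
have [a b h|f [fZ fE]] := presented_lift kapC phiE (rel := vv_rel q
    (T := vv_word m nu) val
    (fun l => freegen K (VvX nu l)) (fun k => freegen K (VvS nu k))
    (fun h => freegen K (VvPi nu h)) (fun i => freegen K (VvE i))).
  apply: famA; have := rmorph_vv_rel phi h.
  congr vv_rel; apply/funext => y; exact/(etrans (phiE _))/free_eval_gen.
exists f; split=> //.
by split=> y; rewrite fE.
Qed.

End Generators.

(** * Sign patterns and folded words *)

Section SignPatterns.

Variable m : nat.
Local Notation P := {ffun 'I_m -> bool}.
Implicit Types (eps : P) (k : 'I_m.-1) (a b l : 'I_m).

Definition swap_pos k l : 'I_m := tperm (lo k) (hi k) l.

Lemma swap_posK k : involutive (swap_pos k).
Proof. exact: tpermK. Qed.

Lemma swap_pos_lo k : swap_pos k (lo k) = hi k. Proof. exact: tpermL. Qed.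
Lemma swap_pos_hi k : swap_pos k (hi k) = lo k. Proof. exact: tpermR. Qed.

Lemma lo_neq_hi k : lo k != hi k.
Proof. by rewrite -val_eqE /=; lia. Qed.

Lemma hi_neq_lo k : (hi k == lo k) = false.
Proof. by rewrite eq_sym; exact/negbTE/lo_neq_hi. Qed.

Definition swap_sign k eps : P := [ffun l => eps (swap_pos k l)].
Definition flip_sign eps : P := [ffun l :
  'I_m => if l == 0%N :> nat then ~~ eps l else eps l].

Lemma swap_signK k : involutive (swap_sign k).
Proof. by move=> eps; apply/ffunP=> l; rewrite !ffunE swap_posK. Qed.

Lemma flip_signK : involutive flip_sign.
Proof.
by move=> eps; apply/ffunP=> l; rewrite !ffunE; case: eqP => // _; rewrite negbK.
Qed.

Lemma swap_sign_same k eps : eps (lo k) = eps (hi k) -> swap_sign k eps = eps.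
Proof.
by move=> h; apply/ffunP=> l; rewrite ffunE /swap_pos; case: tpermP => // ->.
Qed.

(** The order in which the positions of a word of sign pattern eps (true marks
the inverted letters) are met when the word is unfolded: the inverted letters
from right to left, then the others from left to right. *)
Definition before eps a b : bool :=
  if eps a then ~~ eps b || (b < a)%N else ~~ eps b && (a < b)%N.

Definition nat_rank eps l : nat := #|[set a | before eps a l]|.

Lemma before_trans eps b a l : before eps a b -> before eps b l -> before eps a l.
Proof. by rewrite /before; case: (eps a); case: (eps b); case: (eps l) => //=; lia. Qed.

Lemma beforexx eps a : before eps a a = false.
Proof. by rewrite /before; case: (eps a); rewrite /= ltnn. Qed.

Lemma before_total eps a b : a != b -> before eps a b || before eps b a.
Proof. by rewrite -val_eqE /before; case: (eps a); case: (eps b) => //=; lia. Qed.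

Fact nat_rank_lt eps l : (nat_rank eps l < m)%N.
Proof.
rewrite -[X in (_ < X)%N]card_ord; apply/proper_card/properP; split; first exact/subsetP.
by exists l; rewrite // inE beforexx.
Qed.

Definition strand_rank eps l : 'I_m := Ordinal (nat_rank_lt eps l).

Lemma strand_rank_before eps a b : before eps a b ->
  (strand_rank eps a < strand_rank eps b)%N.
Proof.
move=> ab; apply/proper_card/properP; split.
  by apply/subsetP=> l; rewrite !inE => la; exact: before_trans la ab.
by exists a; rewrite inE ?beforexx.
Qed.

Lemma strand_rank_inj eps : injective (strand_rank eps).
Proof.
move=> a b /(congr1 val) ab; apply/eqP/negP => /negP/(@before_total eps).
by case/orP=> /strand_rank_before; rewrite /= in ab *; rewrite ab ltnn.
Qed.

(** Positions of opposite signs are never compared through their values, so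
exchanging two neighbours of opposite signs does not change the order. *)
Lemma before_swap_sign k eps a b : eps (lo k) != eps (hi k) ->
  before (swap_sign k eps) (swap_pos k a) (swap_pos k b) = before eps a b.
Proof.
rewrite /before !ffunE !swap_posK => h; case ea: (eps a); case eb: (eps b) => //=;
  rewrite /swap_pos; do 2![case: tpermP => [?|?|/eqP+ /eqP+]; rewrite -?val_eqE /=];
  subst; move: h; rewrite ?ea ?eb ?eqxx //=; lia.
Qed.

Lemma strand_rank_swap_sign k eps l : eps (lo k) != eps (hi k) ->
  strand_rank (swap_sign k eps) (swap_pos k l) = strand_rank eps l.
Proof.
move=> h; apply/val_inj; rewrite /= /nat_rank -[RHS](card_imset _ (inv_inj (swap_posK k))).
apply: eq_card => a; rewrite !inE; apply/idP/imsetP => [hb|[b]].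
  by exists (swap_pos k a); rewrite ?swap_posK // inE -(before_swap_sign _ _ h) swap_posK.
by rewrite inE -(before_swap_sign _ _ h) => hb ->.
Qed.

(** Position 0 is the last one among the inverted letters or the first one among
the others; either way it stands between the two groups. *)
Lemma strand_rank_flip_sign eps l : strand_rank (flip_sign eps) l = strand_rank eps l.
Proof.
apply/val_inj; apply: eq_card => a; rewrite !inE.
have [->|] := eqVneq a l; first by rewrite !beforexx.
rewrite -val_eqE /before !ffunE /= => al.
have [a0|a0] := eqVneq (a : nat) 0%N; have [l0|l0] := eqVneq (l : nat) 0%N;
  case: (eps a); case: (eps l) => //=; lia.
Qed.

Lemma strand_rank_pos k eps : eps (lo k) = false -> eps (hi k) = false ->
  strand_rank eps (hi k) = (strand_rank eps (lo k)).+1 :> nat.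
Proof.
move=> h1 h2; rewrite /= /nat_rank.
rewrite (cardsD1 (lo k)) inE {1}/before h1 h2 /= ltnSn add1n; congr _.+1.
apply: eq_card => a; rewrite !inE /before h1 h2 -val_eqE /=.
by case ea: (eps a) => /=; [rewrite andbT; apply/eqP=> e; move: ea;
  rewrite (_ : a = lo k) ?h1 //; exact: val_inj | lia].
Qed.

Lemma strand_rank_neg k eps : eps (lo k) = true -> eps (hi k) = true ->
  strand_rank eps (lo k) = (strand_rank eps (hi k)).+1 :> nat.
Proof.
move=> h1 h2; rewrite /= /nat_rank.
rewrite (cardsD1 (hi k)) inE {1}/before h1 h2 /= ltnSn add1n; congr _.+1.
by apply: eq_card => a; rewrite !inE /before h1 h2 -val_eqE /=; case: (eps a) => /=; lia.
Qed.

End SignPatterns.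

Section Folding.

Variables (K : fieldType) (p lam : K) (m : nat).
Local Notation P := {ffun 'I_m -> bool}.
Local Notation I := (Iorb p lam).

Lemma IinvK : involutive (@Iinv K p lam).
Proof. by move=> i; apply/val_inj; rewrite /= invrK. Qed.

(** The word of sign pattern eps that unfolds to j. *)
Definition fold_word (eps : P) (j : m.-tuple I) : m.-tuple I :=
  [tuple if eps l then Iinv (tnth j (strand_rank eps l)) else tnth j (strand_rank eps
    l) | l < m].

Lemma fold_swap_sign k (eps : P) (j : m.-tuple I) : eps (lo k) != eps (hi k) ->
  fold_word (swap_sign k eps) j = swap_word k (fold_word eps j).
Proof.
move=> h; apply: eq_from_tnth => l; rewrite !tnth_mktuple ffunE.
by rewrite -[in LHS](swap_posK k l) strand_rank_swap_sign // swap_posK.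
Qed.

Lemma fold_flip_sign (eps : P) (j : m.-tuple I) : fold_word (flip_sign eps) j =
  flip_word (fold_word eps j).
Proof.
apply: eq_from_tnth => l; rewrite !tnth_mktuple ffunE strand_rank_flip_sign.
by case: eqP => // _; case: (eps l); rewrite ?IinvK.
Qed.

Lemma swap_wordK (T : Type) k : involutive (@swap_word m T k).
Proof. by move=> i; apply: eq_from_tnth => l; rewrite !tnth_mktuple tpermK. Qed.

Lemma klr_weight_swap k (j : m.-tuple I) :
  klr_weight (swap_word k j) = klr_weight j.
Proof.
apply/msetP => x; rewrite !mset_seqE -!sum1_count !big_tuple.
rewrite (reindex_inj (@perm_inj _ (tperm (lo k) (hi k)))) /=.
by apply: eq_bigl => l; rewrite tnth_mktuple tpermK.
Qed.

Lemma vv_weightE (j : m.-tuple I) x :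
  vv_weight j x = (\sum_(l < m) ((tnth j l == x) + (Iinv (tnth j l) == x)))%N.
Proof.
rewrite msetE2 !mset_seqE -!sum1_count big_map !big_tuple big_split /=.
congr (_ + _)%N; rewrite big_mkcond; apply: eq_bigr => l _.
  by rewrite /=; case: eqP.
by case: eqP.
Qed.

(** The weight counts every letter together with its inverse, which hides both
the permutation and the inversions. *)
Lemma vv_weight_fold_word (eps : P) (j : m.-tuple I) : vv_weight (fold_word eps j) =
  vv_weight j.
Proof.
apply/msetP => x; rewrite !vv_weightE [RHS](reindex_inj (@strand_rank_inj _ eps)) /=.
by apply: eq_bigr => l _; rewrite tnth_mktuple; case: (eps l); rewrite ?IinvK 1?addnC.
Qed.

Lemma vv_weight_klr (j : m.-tuple I) :
  vv_weight j = (klr_weight j `+` mset_inv (klr_weight j))%mset.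
Proof.
apply/msetP => x; rewrite !msetE2 !mset_seqE; congr addn.
rewrite !count_map; by rewrite /klr_weight (seq.permP (perm_eq_seq_mset j)).
Qed.

End Folding.

(** * The polynomials in the relations *)

Section Coefficients.

Variables (K : fieldType) (p q lam : K) (A : pzRingType).
Local Notation I := (Iorb p lam).
Implicit Types (a b c : I) (u v z : A).

(** The four formulas of the relations with letters and variables as separate
arguments: on an inverted letter they are evaluated at minus the variable. *)
Definition quad_poly a b u v : A :=
  if a == b then 0
  else if arrow_both a b then (v - u) * (u - v)
  else if arrow_to a b then u - v
  else if arrow_to b a then v - u
  else 1.

Definition braid_poly a b u z v : A :=
  if arrow_both a b then z *+ 2 - v - u
  else if arrow_to a b then 1
  else if arrow_to b a then -1
  else 0.

Definition pi_poly a u : A :=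
  if Iorb_val a == q then u else if Iorb_val a == q^-1 then - u else 1.

(** The derivative of pi_poly in its variable. *)
Definition pi_poly_diff a : A :=
  if Iorb_val a == q then 1 else if Iorb_val a == q^-1 then -1 else 0.

Lemma arrow_bothC a b : arrow_both a b = arrow_both b a.
Proof. by rewrite /arrow_both andbC. Qed.

Lemma arrow_toN a b : arrow_to a b -> arrow_to b a = false.
Proof. by rewrite /arrow_to => /andP[_ /negbTE->]. Qed.

Lemma quad_polyC a b u v : quad_poly a b u v = quad_poly b a v u.
Proof.
rewrite /quad_poly eq_sym arrow_bothC; case: eqP => // _; case: ifP => _.
  by rewrite -(opprB u v) mulNr mulrN.
by case: ifP => [/arrow_toN->|_].
Qed.

Lemma comm_quad_poly a b u v z : GRing.comm z u -> GRing.comm z v ->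
  GRing.comm z (quad_poly a b u v).
Proof.
move=> hu hv; rewrite /quad_poly; do !case: ifP => _;
  by [exact: commr0 | exact: commr1 | do ?apply: commrM; apply: commrB].
Qed.

Lemma quad_poly_shift a b u v : quad_poly a b u v = quad_poly a b 0 (v - u).
Proof. by rewrite /quad_poly subr0 sub0r opprB. Qed.

Lemma braid_polyC a b u z v : braid_poly a b u z v = braid_poly a b v z u.
Proof. by rewrite /braid_poly addrAC. Qed.

Lemma comm_braid_poly a b u v w z : GRing.comm z u -> GRing.comm z v -> GRing.comm z w ->
  GRing.comm z (braid_poly a b u v w).
Proof.
move=> hu hv hw; rewrite /braid_poly; do !case: ifP => _;
  by [exact: commr0 | exact: commr1 | exact: commrN1
     | do 2?apply: commrB => //; apply: commrMn].
Qed.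

Lemma comm_pi_poly a u z : GRing.comm z u -> GRing.comm z (pi_poly a u).
Proof.
by move=> hu; rewrite /pi_poly; do !case: ifP => _; [|exact: commrN|exact: commr1].
Qed.

Lemma comm_pi_poly_diff a z : GRing.comm z (pi_poly_diff a).
Proof.
by rewrite /pi_poly_diff; do !case: ifP => _; [exact: commr1|exact: commrN1|exact: commr0].
Qed.

(* S is a crossing that moves u to v up to the error term b, on the component *)
(* cut out by e.                                                              *)
Section Demazure.

Variables (S u v z e b : A).
Hypothesis zb : GRing.comm z b.
Hypothesis vb : GRing.comm v b.
Hypothesis ue : GRing.comm u e.
Hypothesis ze : GRing.comm z e.
Hypothesis Sz : GRing.comm S z.
Hypothesis Su : S * u * e = v * S * e - b * e.

Lemma demazure_sqr y y' : GRing.comm y e -> GRing.comm y' b ->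
  S * y * e = y' * S * e - b * e ->
  S * (y * y) * e = y' * y' * S * e - b * (y + y') * e.
Proof.
move=> ye yb h.
rewrite mulrA -(mulrA _ y e) ye mulrA h mulrBl -(mulrA _ e y) -ye mulrA.
rewrite -(mulrA y' S y) -(mulrA y' _ e) h mulrBr !mulrA -addrA -opprD yb.
by rewrite -(mulrA b e y) -ye mulrA -!mulrDl -mulrDr [y' + y]addrC.
Qed.

(** Moving a quadratic coefficient past a crossing costs its divided difference
in the moved variable, and this is the right-hand side of the braid relation. *)
Lemma demazure_quad_poly c a : c != a ->
  S * quad_poly c a z u * e = quad_poly c a z v * S * e - b * braid_poly a c u z v * e.
Proof.
move=> ca; rewrite /quad_poly /braid_poly (negbTE ca) arrow_bothC.
have hy : S * (u - z) * e = (v - z) * S * e - b * e.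
  rewrite mulrBr !mulrBl Su -addrA -[X in _ = X]addrA; congr (_ + _).
  by rewrite Sz addrC.
case: ifP => _.
  rewrite -(opprB u z) -(opprB v z) !mulrN !mulNr.
  rewrite (demazure_sqr _ _ hy); first 1 last.
  - by apply/commr_sym/commrB; exact/commr_sym.
  - by apply/commr_sym/commrB; exact/commr_sym.
  rewrite opprB addrC; congr (_ + _); rewrite -mulNr -mulrN; congr (_ * _ * _).
  by rewrite opprB opprB addrACA -opprD -mulr2n addrA.
case h: (arrow_to c a).
  rewrite (arrow_toN h) -(opprB u z) -(opprB v z) !mulrN !mulNr hy mulr1.
  by rewrite opprB opprK addrC.
by case: ifP => _; rewrite ?mulr1 // mulr0 mul0r subr0 mul1r.
Qed.

Lemma demazure_pi_poly a :
  S * pi_poly a u * e = pi_poly a v * S * e - b * pi_poly_diff a * e.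
Proof.
rewrite /pi_poly /pi_poly_diff; case: ifP => _; first by rewrite mulr1.
case: ifP => _; last by rewrite mulr1 mulr0 mul0r subr0 mul1r.
by rewrite mulrN !mulNr mulrN1 mulNr opprK Su opprB addrC.
Qed.

End Demazure.

(** A product that the crossing permutes passes through: the error terms of the
two factors are opposite and cancel. *)
Lemma demazure_mul (S f f' g g' D e : A) :
  S * f * e = f' * S * e - D * e -> S * g * e = g' * S * e + D * e ->
  GRing.comm g e -> f' * D = D * g -> S * (f * g) * e = f' * g' * S * e.
Proof.
move=> hf hg ge hD.
rewrite mulrA -(mulrA _ g) ge mulrA hf mulrBl -!(mulrA _ e) -ge.
rewrite -(mulrA f') -(mulrA f') (mulrA S) hg mulrDr !mulrA hD.
by rewrite addrK.
Qed.

End Coefficients.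

Section InverseLetters.

Variables (K : fieldType) (p q lam : K).
Hypothesis hp : p != 0.
Local Notation I := (Iorb p lam).
Implicit Types (a b c : I).

Lemma quiver_arrow_inv a b : quiver_arrow (Iinv a) (Iinv b) = quiver_arrow b a.
Proof.
rewrite /quiver_arrow /=; have p0 : p ^+ 2 != 0 by rewrite expf_neq0.
apply/eqP/eqP => [h|->]; last by rewrite invfM mulrA mulfV ?mul1r.
by rewrite -[Iorb_val a]invrK h invfM invrK mulrA mulfV ?mul1r.
Qed.

Lemma arrow_to_inv a b : arrow_to (Iinv a) (Iinv b) = arrow_to b a.
Proof. by rewrite /arrow_to !quiver_arrow_inv. Qed.

Lemma arrow_both_inv a b : arrow_both (Iinv a) (Iinv b) = arrow_both a b.
Proof. by rewrite /arrow_both !quiver_arrow_inv andbC. Qed.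

Lemma eq_inv a b : (Iinv a == Iinv b) = (a == b).
Proof. exact/inj_eq/inv_inj/IinvK. Qed.

Variable A : pzRingType.
Implicit Types (u v z : A).

(** Inverting both letters reverses the arrows between them, and the negated
variables make up for that. *)
Lemma quad_poly_inv a b u v : quad_poly (Iinv a) (Iinv b) (- u) (- v) = quad_poly a b u v.
Proof.
rewrite /quad_poly eq_inv arrow_both_inv !arrow_to_inv.
case: ifP => // _; rewrite !opprK ![- _ + _]addrC.
case: ifP => _; first by rewrite -(opprB v u) mulNr mulrN.
by case: ifP => [/arrow_toN->|].
Qed.

Lemma braid_poly_inv a b u z v : braid_poly (Iinv a) (Iinv b) (- u) (- z) (- v) =
  - braid_poly a b u z v.
Proof.
rewrite /braid_poly arrow_both_inv !arrow_to_inv.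
case: ifP => _; first by rewrite mulNrn !opprD.
case: ifP => [/arrow_toN->|_]; first by rewrite opprK.
by case: ifP; rewrite ?oppr0.
Qed.

Lemma pi_poly_inv a u : Iinv a != a -> pi_poly q (Iinv a) (- u) = pi_poly q a u.
Proof.
rewrite /pi_poly -!val_eqE /= => aa.
have e1 : ((Iorb_val a)^-1 == q) = (Iorb_val a == q^-1).
  by rewrite -(inj_eq invr_inj) invrK.
rewrite e1 (inj_eq invr_inj) opprK.
have [e|] := eqVneq (Iorb_val a) q^-1; have [e'|] := eqVneq (Iorb_val a) q => //.
by move: aa; rewrite {1}e invrK e' eqxx.
Qed.

End InverseLetters.

(** * The coefficients of the strands *)

Section StrandDefinitions.

Variables (K : fieldType) (p q lam : K) (m : nat).
Variable nut : {mset Iorb p lam}%mset.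
Local Notation I := (Iorb p lam).
Local Notation KW := (klr_word m nut).

(** A letter of a word of W: whether it is inverted, and its position in the
unfolded word. *)
Definition strand : Type := (bool * 'I_m)%type.
Implicit Types (s t : strand).

Definition strand_at (eps : {ffun 'I_m -> bool}) (l : 'I_m) : strand :=
  (eps l, strand_rank eps l).

Definition strand_opp s : strand := (~~ s.1, s.2).

(** Neighbours of the same sign in some folded word. Inverted letters are unfolded
from right to left, hence the two cases. *)
Definition adjacent s t : bool :=
  (s.1 == t.1) && (if s.1 then s.2 == t.2.+1 :> nat else t.2 == s.2.+1 :> nat).

Definition strand_letter s (j : m.-tuple I) : I :=
  if s.1 then Iinv (tnth j s.2) else tnth j s.2.

Variables (A : pzRingType) (X : 'I_m -> A) (S : 'I_m.-1 -> A) (E : KW -> A).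

Definition strand_x s : A := if s.1 then - X s.2 else X s.2.

(** The generator sigma of R that exchanges the positions of two adjacent
strands. *)
Definition cross s t : A := if insub (minn s.2 t.2) is Some d then S d else 0.

Definition quad s t : A :=
  \sum_(j : KW)
     quad_poly (strand_letter s (val j)) (strand_letter t (val j)) (strand_x s)
       (strand_x t) * E j.

Definition piquad s : A :=
  \sum_(j : KW) pi_poly q (strand_letter s (val j)) (strand_x s) * E j.

(** The coefficient of sigma_k in the row where strands s and t stand at the
positions k and k + 1. If just one of them is inverted, it is 1 when that is t; the
opposite move then carries all of sigma_k^2. *)
Definition sigma_coef s t : A :=
  if s.1 == t.1 then cross s t else if s.1 then quad s t else 1.

Definition pi_coef s : A := if s.1 then 1 else piquad s.

End StrandDefinitions.

Section StrandGeometry.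

Variables (K : fieldType) (p q lam : K) (m : nat).
Local Notation I := (Iorb p lam).
Local Notation P := {ffun 'I_m -> bool}.
Implicit Types (s t : strand m) (eps : P).

Lemma strand_at_inj eps a b : a != b ->
  (strand_at eps a).2 != (strand_at eps b).2.
Proof. by rewrite (inj_eq (@strand_rank_inj _ eps)). Qed.

Lemma adjacent_strand_at eps k : eps (lo k) = eps (hi k) ->
  adjacent (strand_at eps (lo k)) (strand_at eps (hi k)).
Proof.
rewrite /adjacent /strand_at /= => h; rewrite h eqxx; case e: (eps (hi k)); rewrite e in h.
  exact/eqP/(strand_rank_neg h e).
exact/eqP/(strand_rank_pos h e).
Qed.

Lemma strand_at_swap_sign k eps l : eps (lo k) != eps (hi k) ->
  strand_at (swap_sign k eps) l = strand_at eps (swap_pos k l).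
Proof. by move=> h; rewrite /strand_at ffunE -{2}(swap_posK k l) strand_rank_swap_sign. Qed.

Lemma strand_at_flip_sign eps l : strand_at (flip_sign eps) l =
  if l == 0%N :> nat then strand_opp (strand_at eps l) else strand_at eps l.
Proof. by rewrite /strand_at strand_rank_flip_sign ffunE; case: eqP. Qed.

Lemma tnth_fold_word eps (j : m.-tuple I) l : tnth (fold_word eps j) l =
  strand_letter (strand_at eps l) j.
Proof. by rewrite tnth_mktuple. Qed.

(** Of two inverted strands, the first one comes second in R. *)
Lemma adjacent_pos s t : adjacent s t -> exists d : 'I_m.-1,
  [/\ minn s.2 t.2 = d, (if s.1 then t.2 else s.2) = lo d
    & (if s.1 then s.2 else t.2) = hi d].
Proof.
rewrite /adjacent; case: s t => [b a] [b' c] /= /andP[_] h.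
have hm : (minn a c < m.-1)%N.
  by case: a c h => [a ha] [c hc] /=; case: b => /eqP /=; lia.
exists (Ordinal hm); split=> //; apply/val_inj => /=; case: b h => /eqP; lia.
Qed.

End StrandGeometry.

Section StrandRelations.

Variables (K : fieldType) (p q lam : K) (m : nat).
Variable nut : {mset Iorb p lam}%mset.
Hypothesis hp : p != 0.
Hypothesis hsum : forall i : Iorb p lam,
     ~~ ((1 <= nut i)%N && (1 <= nut (Iinv i))%N).
Local Notation I := (Iorb p lam).
Local Notation KW := (klr_word m nut).
Implicit Types (s t u z : strand m).

Lemma klr_word_mem (j : KW) l : (0 < nut (tnth (val j) l))%N.
Proof. by rewrite -{1}(eqP (valP j)); apply: klr_weight_supp; exact: mem_tnth. Qed.

(** Here it matters that nut does not contain a letter together with its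
inverse. *)
Lemma klr_word_memN (j : KW) l : nut (Iinv (tnth (val j) l)) = 0%N.
Proof.
by have := hsum (tnth (val j) l); rewrite klr_word_mem /= -eqn0Ngt => /eqP.
Qed.

Lemma strand_letter_mem s (j : KW) : (0 < nut (strand_letter s (val j)))%N = ~~ s.1.
Proof.
by rewrite /strand_letter; case: s.1; rewrite ?klr_word_mem // klr_word_memN.
Qed.

Lemma strand_letter_sign s t (j j' : KW) : strand_letter s (val j) =
  strand_letter t (val j') -> s.1 = t.1.
Proof. by move=> h; apply/negb_inj;
  rewrite -(strand_letter_mem s j) h strand_letter_mem. Qed.

(** An inverted letter lies outside nut, the others lie in nut. *)
Lemma strand_letter_neq s t (j : KW) : s.1 != t.1 ->
  strand_letter s (val j) != strand_letter t (val j).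
Proof. by move=> st; apply/eqP => /strand_letter_sign e; rewrite e eqxx in st. Qed.

Lemma strand_letter_opp s (j : m.-tuple I) : strand_letter (strand_opp s) j =
  Iinv (strand_letter s j).
Proof. by rewrite /strand_letter /strand_opp; case: s.1; rewrite //= IinvK. Qed.

Lemma strand_letter_invP s (j : KW) :
  Iinv (strand_letter s (val j)) != strand_letter s (val j).
Proof. by rewrite -strand_letter_opp; apply: strand_letter_neq; case: (s) => -[]. Qed.

Lemma klr_swap_subproof k (j : KW) : klr_weight (swap_word k (val j)) == nut.
Proof. by rewrite klr_weight_swap (valP j). Qed.
Definition klr_swap k (j : KW) : KW := Sub (swap_word k (val j)) (klr_swap_subproof k j).

Lemma klr_swapK k : involutive (klr_swap k).
Proof. by move=> j; apply/val_inj; rewrite /= swap_wordK. Qed.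

Lemma strand_letter_klr_swap_adjacent (k : 'I_m.-1) s t (j : KW) : adjacent s t ->
  minn s.2 t.2 = k :> nat ->
  (strand_letter s (val (klr_swap k j)) = strand_letter t (val j)) *
  (strand_letter t (val (klr_swap k j)) = strand_letter s (val j)).
Proof.
move=> st; have [d [-> h1 h2]] := adjacent_pos st; move=> /val_inj dk; subst d.
case/andP: st => /eqP st _; rewrite /strand_letter /= !tnth_mktuple -st.
by move: h1 h2; case: (s.1) => -> ->; rewrite tpermL tpermR.
Qed.

Lemma strand_letter_klr_swap_far (k : 'I_m.-1) z (j : KW) : z.2 != lo k -> z.2 != hi k ->
  strand_letter z (val (klr_swap k j)) = strand_letter z (val j).
Proof. by move=> h1 h2; rewrite /strand_letter /= !tnth_mktuple tpermD // eq_sym. Qed.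

Variables (R : pzRingType) (X : 'I_m -> R) (S : 'I_m.-1 -> R) (E : KW -> R).
Hypothesis famR : klr_family (T := KW) val X S E.

Local Notation strand_x := (strand_x X).
Local Notation cross := (cross S).
Local Notation quad := (quad X E).
Local Notation piquad := (piquad q X E).

Lemma klrEE i j : E i * E j = if i == j then E i else 0.
Proof. exact/famR/klr_ee. Qed.
Lemma klrE1 : \sum_(j : KW) E j = 1.
Proof. exact/famR/klr_sum. Qed.
Lemma klrXE l j : X l * E j = E j * X l.
Proof. exact/famR/klr_xe. Qed.
Lemma klrXX l l' : X l * X l' = X l' * X l.
Proof. exact/famR/klr_xx. Qed.
Lemma klrSE k j : S k * E j = E (klr_swap k j) * S k.
Proof. exact/famR/klr_se. Qed.
Lemma klrSX k l j : S k * X l * E j =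
  X (swap_pos k l) * S k * E j + demazure_coef (T := KW) val R k l j * E j.
Proof.
have /famR <- := klr_sx (T := KW) val X S E k l j.
by rewrite mulrBl addrC subrK.
Qed.

Lemma eq_klr_mulE (a b : R) : (forall j, a * E j = b * E j) -> a = b.
Proof.
by move=> h; rewrite -[a]mulr1 -[b]mulr1 -klrE1 !mulr_sumr; apply: eq_bigr.
Qed.

Lemma strand_xE s j : strand_x s * E j = E j * strand_x s.
Proof. by rewrite /strand_x; case: s.1; rewrite ?mulNr ?mulrN klrXE. Qed.
Lemma strand_xC s t : strand_x s * strand_x t = strand_x t * strand_x s.
Proof. by rewrite /strand_x; case: s.1; case: t.1; rewrite ?mulNr ?mulrN ?mulNr klrXX. Qed.

Section Central.
Variable F : KW -> R.
(** The element acting as F j on the component of the word j. *)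
Definition color_sum : R := \sum_(j : KW) F j * E j.
Lemma color_sum_E j : color_sum * E j = F j * E j.
Proof.
rewrite /color_sum mulr_suml (bigD1 j) //= -mulrA klrEE eqxx big1 ?addr0 // => i ij.
by rewrite -mulrA klrEE (negbTE ij) mulr0.
Qed.
Hypothesis FE : forall i j, GRing.comm (E i) (F j).
Lemma color_sum_comm j : GRing.comm (E j) color_sum.
Proof.
apply: commr_sum => i _; apply: commrM => //; rewrite /GRing.comm !klrEE eq_sym.
by case: eqP => [->|].
Qed.
Lemma comm_color_sum a : (forall j, GRing.comm a (F j)) -> (forall j, GRing.comm a (E j)) ->
   GRing.comm a color_sum.
Proof. by move=> aF aE; apply: commr_sum => i _; apply: commrM. Qed.
End Central.

Lemma quadE s t j : quad s t * E j =
  quad_poly (strand_letter s (val j)) (strand_letter t (val j)) (strand_x s) (strand_x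
    t) * E j.
Proof. exact: (color_sum_E (fun j => _)). Qed.
Lemma piquadE s j : piquad s * E j = pi_poly q (strand_letter s (val j)) (strand_x s) * E j.
Proof. exact: (color_sum_E (fun j => _)). Qed.
Lemma E_quad s t j : quad s t * E j = E j * quad s t.
Proof.
apply/esym/color_sum_comm => i {}j; apply: comm_quad_poly; rewrite /GRing.comm;
  exact/esym/strand_xE.
Qed.
Lemma E_piquad s j : piquad s * E j = E j * piquad s.
Proof.
by apply/esym/color_sum_comm => i {}j; apply: comm_pi_poly; exact/esym/strand_xE.
Qed.
Lemma strand_x_quad z s t : strand_x z * quad s t = quad s t * strand_x z.
Proof.
apply: (comm_color_sum (F := fun j => _)) => j; last exact: strand_xE.
by apply: comm_quad_poly; exact: strand_xC.
Qed.
Lemma strand_x_piquad z s : strand_x z * piquad s = piquad s * strand_x z.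
Proof.
apply: (comm_color_sum (F := fun j => _)) => j; last exact: strand_xE.
by apply: comm_pi_poly; exact: strand_xC.
Qed.
Lemma quad_quad s t s' t' : quad s t * quad s' t' = quad s' t' * quad s t.
Proof.
apply: (comm_color_sum (F := fun j => _)) => j; last exact: E_quad.
by apply: comm_quad_poly; exact/esym/strand_x_quad.
Qed.
Lemma piquad_quad z s t : piquad z * quad s t = quad s t * piquad z.
Proof.
apply: (comm_color_sum (F := fun j => _)) => j; last exact: E_piquad.
by apply: comm_quad_poly; exact/esym/strand_x_piquad.
Qed.
Lemma piquad_piquad z s : piquad z * piquad s = piquad s * piquad z.
Proof.
apply: (comm_color_sum (F := fun j => _)) => j; last exact: E_piquad.
by apply: comm_pi_poly; exact/esym/strand_x_piquad.
Qed.
Lemma quadC s t : quad s t = quad t s.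
Proof. by apply: eq_bigr => j _; rewrite quad_polyC. Qed.
Lemma crossC s t : cross s t = cross t s.
Proof. by rewrite /cross minnC. Qed.

Lemma piquad_opp s : piquad (strand_opp s) = piquad s.
Proof.
apply: eq_bigr => j _; rewrite strand_letter_opp.
have -> : strand_x (strand_opp s) = - strand_x s by rewrite /strand_x /=; case: s.1;
  rewrite //= opprK.
by rewrite pi_poly_inv // strand_letter_invP.
Qed.

(* Two adjacent strands of the same sign obey the relations of R, whatever    *)
(* the sign.                                                                  *)
Section Adjacent.

Variables s t : strand m.
Hypothesis st : adjacent s t.

Lemma cross_adjacent : exists d : 'I_m.-1,
  [/\ cross s t = S d, minn s.2 t.2 = d, (if s.1 then t.2 else s.2) = lo d
    & (if s.1 then s.2 else t.2) = hi d].
Proof.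
have [d [h1 h2 h3]] := adjacent_pos st; exists d; split=> //.
by rewrite /cross h1 valK.
Qed.

Definition swap_strands (j : KW) :
  KW := if insub (minn s.2 t.2) is Some d then klr_swap d j else j.

Lemma cross_E j : cross s t * E j = E (swap_strands j) * cross s t.
Proof. by have [d [-> h _ _]] := cross_adjacent; rewrite /swap_strands h valK klrSE. Qed.

Lemma swap_strandsK : involutive swap_strands.
Proof. by rewrite /swap_strands => j; case: insubP => // d _ _; rewrite klr_swapK. Qed.

Lemma strand_letter_swapl j : strand_letter s (val (swap_strands j)) =
  strand_letter t (val j).
Proof.
have [d [h _ _]] := adjacent_pos st; rewrite /swap_strands h valK.
by rewrite (strand_letter_klr_swap_adjacent _ st).
Qed.

Lemma strand_letter_swapr j : strand_letter t (val (swap_strands j)) =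
  strand_letter s (val j).
Proof.
have [d [h _ _]] := adjacent_pos st; rewrite /swap_strands h valK.
by rewrite (strand_letter_klr_swap_adjacent _ st).
Qed.

Lemma adjacent_far z d : (if s.1 then t.2 else s.2) =
  lo d -> (if s.1 then s.2 else t.2) = hi d ->
  z.2 != s.2 -> z.2 != t.2 -> (z.2 != lo d) && (z.2 != hi d).
Proof. by case: s.1 => <- <- h1 h2; rewrite h1 h2. Qed.

Lemma strand_letter_swap z j : z.2 != s.2 -> z.2 != t.2 ->
  strand_letter z (val (swap_strands j)) = strand_letter z (val j).
Proof.
move=> h1 h2; have [d [h hl hh]] := adjacent_pos st; rewrite /swap_strands h valK.
by have /andP[] := adjacent_far hl hh h1 h2; exact: strand_letter_klr_swap_far.
Qed.

Definition same_letter (j : KW) :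
  R := (strand_letter s (val j) == strand_letter t (val j))%:R.

Lemma cross_xl j : cross s t * strand_x s * E j =
  strand_x t * cross s t * E j - same_letter j * E j.
Proof.
have [d [-> _ hl hh]] := cross_adjacent; case/andP: (st) => /eqP e _.
rewrite /same_letter /strand_x /strand_letter -e; move: hl hh; case: (s.1) => -> ->.
  rewrite mulrN mulNr klrSX /swap_pos tpermR !mulNr opprD; congr (_ - _ * _).
  rewrite /demazure_coef eq_inv eqxx hi_neq_lo /=.
  by rewrite [in RHS]eq_sym; case: eqP.
rewrite klrSX /swap_pos tpermL -mulNr; congr (_ + _ * _).
by rewrite /demazure_coef eqxx; case: eqP; rewrite ?oppr0.
Qed.

Lemma cross_xr j : cross s t * strand_x t * E j =
  strand_x s * cross s t * E j + same_letter j * E j.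
Proof.
have [d [-> _ hl hh]] := cross_adjacent; case/andP: (st) => /eqP e _.
rewrite /same_letter /strand_x /strand_letter -e; move: hl hh; case: (s.1) => -> ->.
  rewrite mulrN mulNr klrSX /swap_pos tpermL !mulNr opprD; congr (_ + _).
  rewrite -mulNr; congr (_ * _).
  rewrite /demazure_coef eq_inv eqxx.
  by rewrite [in RHS]eq_sym; case: eqP; rewrite ?opprK ?oppr0.
rewrite klrSX /swap_pos tpermR; congr (_ + _ * _).
rewrite /demazure_coef eqxx hi_neq_lo.
by case: eqP; rewrite ?oppr0.
Qed.

Lemma cross_xfar z : z.2 != s.2 -> z.2 != t.2 -> cross s t * strand_x z =
  strand_x z * cross s t.
Proof.
move=> h1 h2; have [d [-> _ hl hh]] := cross_adjacent.
have /andP[hzl hzh] := adjacent_far hl hh h1 h2.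
have Sz : S d * X z.2 = X z.2 * S d.
  apply: eq_klr_mulE => j; rewrite klrSX /swap_pos tpermD 1?eq_sym //.
  by rewrite /demazure_coef (negbTE hzl) (negbTE hzh) if_same mul0r addr0.
by rewrite /strand_x; case: z.1; rewrite ?mulrN ?mulNr Sz.
Qed.

Lemma cross_sqr j : cross s t * cross s t * E j =
  quad_poly (strand_letter s (val j)) (strand_letter t (val j)) (strand_x s) (strand_x
    t) * E j.
Proof.
have [d [-> _ hl hh]] := cross_adjacent; case/andP: (st) => /eqP e _.
have /famR := klr_quad (T := KW) val X S E d j; rewrite expr2 => ->; congr (_ * _).
rewrite /strand_x /strand_letter -e; move: hl hh; case: (s.1) => -> ->.
  by rewrite quad_poly_inv // quad_polyC.
by [].
Qed.

Lemma same_letterC j a : a * same_letter j = same_letter j * a.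
Proof. exact: commr_nat. Qed.

Lemma cross_quadl z j : z.1 != s.1 -> z.2 != s.2 -> z.2 != t.2 ->
  cross s t * quad z s * E j = quad z t * cross s t * E j
   - same_letter j * braid_poly (strand_letter s (val j)) (strand_letter z (val j))
     (strand_x s) (strand_x z) (strand_x t) * E j.
Proof.
move=> zs z1 z2; rewrite -!mulrA quadE cross_E 2!mulrA quadE strand_letter_swapr
  strand_letter_swap //.
rewrite (demazure_quad_poly _ _ _ _ _ (cross_xl j)) //; try exact: same_letterC;
  try exact: strand_xE.
- by rewrite -!mulrA cross_E.
- exact: cross_xfar.
- exact: strand_letter_neq.
Qed.

Lemma cross_quadr z j : z.1 != s.1 -> z.2 != s.2 -> z.2 != t.2 ->
  cross s t * quad z t * E j = quad z s * cross s t * E j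
   + same_letter j * braid_poly (strand_letter s (val j)) (strand_letter z (val j))
     (strand_x s) (strand_x z) (strand_x t) * E j.
Proof.
move=> zs z1 z2; rewrite -!mulrA quadE cross_E 2!mulrA quadE strand_letter_swapl
  strand_letter_swap //.
have h : cross s t * strand_x t * E j =
  strand_x s * cross s t * E j - (- same_letter j) * E j.
  by rewrite mulNr opprK; exact: cross_xr.
rewrite (demazure_quad_poly _ _ _ _ _ h) //; try exact: strand_xE.
- rewrite !mulNr opprK -!mulrA cross_E braid_polyC /same_letter.
  by case: eqP => [->|_] //; rewrite !mul0r.
- by apply: commrN; exact: same_letterC.
- by apply: commrN; exact: same_letterC.
- exact: cross_xfar.
- by apply: strand_letter_neq; case/andP: st => /eqP <-.
Qed.

(** Two adjacent strands exchanged after both have crossed z: the product of the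
two coefficients is symmetric in them. *)
Lemma cross_quad_quad z : z.1 != s.1 -> z.2 != s.2 -> z.2 != t.2 ->
  cross s t * (quad z s * quad z t) = quad z s * quad z t * cross s t.
Proof.
move=> zs z1 z2; apply: eq_klr_mulE => j; rewrite [in RHS]quad_quad.
apply: demazure_mul (cross_quadl _ _ _ _) (cross_quadr _ _ _ _) _ _ => //.
  exact: E_quad.
rewrite mulrA same_letterC -!mulrA; congr (_ * _).
by apply: comm_braid_poly; exact/esym/strand_x_quad.
Qed.

Lemma cross_piquadl j : cross s t * piquad s * E j =
  piquad t * cross s t * E j - same_letter j * pi_poly_diff q R (strand_letter s (val
    j)) * E j.
Proof.
rewrite -!mulrA piquadE cross_E mulrA mulrA piquadE strand_letter_swapr.
by rewrite (demazure_pi_poly _ (cross_xl j)) -!mulrA cross_E.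
Qed.

Lemma cross_piquadr j : cross s t * piquad t * E j =
  piquad s * cross s t * E j + same_letter j * pi_poly_diff q R (strand_letter s (val
    j)) * E j.
Proof.
rewrite -!mulrA piquadE cross_E mulrA mulrA piquadE strand_letter_swapl.
have h : cross s t * strand_x t * E j =
  strand_x s * cross s t * E j - (- same_letter j) * E j.
  by rewrite mulNr opprK; exact: cross_xr.
rewrite (demazure_pi_poly _ h) -!mulrA cross_E !mulNr opprK /same_letter.
by case: eqP => [->|_] //; rewrite !mul0r.
Qed.

Lemma cross_piquad_piquad : cross s t * (piquad s * piquad t) =
  piquad s * piquad t * cross s t.
Proof.
apply: eq_klr_mulE => j; rewrite [in RHS]piquad_piquad.
apply: demazure_mul (cross_piquadl j) (cross_piquadr j) _ _; first exact: E_piquad.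
rewrite mulrA same_letterC -!mulrA; congr (_ * _); exact: comm_pi_poly_diff.
Qed.

Lemma strand_x_opp z : strand_x (strand_opp z) = - strand_x z.
Proof. by rewrite /strand_x /=; case: z.1; rewrite //= opprK. Qed.

(** The coefficient of a strand and the inverse of an adjacent one depends on
their variables only through the sum, which is symmetric. *)
Lemma cross_quad_opp : cross s t * quad (strand_opp s) t =
  quad (strand_opp s) t * cross s t.
Proof.
have Sy : cross s t * (strand_x t + strand_x s) = (strand_x t + strand_x s) * cross s t.
  apply: eq_klr_mulE => j; rewrite mulrDr !mulrDl cross_xr cross_xl.
  by rewrite addrACA subrr addr0 addrC.
apply: eq_klr_mulE => j; rewrite -!mulrA quadE cross_E mulrA mulrA quadE.
rewrite !strand_letter_opp strand_letter_swapl strand_letter_swapr !strand_x_opp.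
rewrite [in RHS]quad_polyC -[in RHS](quad_poly_inv hp) !IinvK opprK.
rewrite quad_poly_shift [in RHS]quad_poly_shift !opprK [strand_x s + _]addrC.
rewrite -[in RHS]mulrA -cross_E !mulrA; congr (_ * _).
by apply: comm_quad_poly; [exact: commr0 | exact: Sy].
Qed.

Lemma cross_quadfar z z' : z.2 != s.2 -> z.2 != t.2 -> z'.2 != s.2 -> z'.2 != t.2 ->
  cross s t * quad z z' = quad z z' * cross s t.
Proof.
move=> h1 h2 h3 h4.
apply: eq_klr_mulE => j; rewrite
  -!mulrA quadE cross_E mulrA mulrA quadE !strand_letter_swap //.
rewrite -[in RHS]mulrA -cross_E !mulrA; congr (_ * _).
by apply: comm_quad_poly; exact: cross_xfar.
Qed.

Lemma cross_piquadfar z : z.2 != s.2 -> z.2 != t.2 -> cross s t * piquad z =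
  piquad z * cross s t.
Proof.
move=> h1 h2.
apply: eq_klr_mulE => j; rewrite
  -!mulrA piquadE cross_E mulrA mulrA piquadE !strand_letter_swap //.
rewrite -[in RHS]mulrA -cross_E !mulrA; congr (_ * _).
by apply: comm_pi_poly; exact: cross_xfar.
Qed.

End Adjacent.

Lemma cross_crossfar s t s' t' : adjacent s t -> adjacent s' t' ->
  s'.2 != s.2 -> s'.2 != t.2 -> t'.2 != s.2 -> t'.2 != t.2 ->
  cross s t * cross s' t' = cross s' t' * cross s t.
Proof.
move=> st st'.
have [d [-> _ h1 h2]] := cross_adjacent st; have [d' [-> _ h1' h2']] := cross_adjacent st'.
move=> n1 n2 n3 n4.
have : (lo d != lo d') && (lo d != hi d') && (hi d != lo d') && (hi d != hi d').
  rewrite -h1 -h2 -h1' -h2' ![_ == (if s'.1 then _ else _)]eq_sym.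
  by case: s.1; case: s'.1; rewrite n1 n2 n3 n4.
rewrite -!val_eqE /= => h; apply/famR/klr_ss; clear -h; lia.
Qed.

(** On inverted strands the two sides of the braid relation of R are exchanged;
the sign this produces is that of braid_poly_inv. *)
Lemma cross_braid s t u j : adjacent s t -> adjacent t u ->
  (cross t u * cross s t * cross t u - cross s t * cross t u * cross s t) * E j =
  (if strand_letter s (val j) != strand_letter u (val j) then 0
   else braid_poly (strand_letter s (val j)) (strand_letter t (val j)) (strand_x s)
     (strand_x t) (strand_x u)) * E j.
Proof.
move=> st tu.
have [d [-> _ h1 h2]] := cross_adjacent st; have [d' [-> _ h1' h2']] := cross_adjacent tu.
move: h1 h2 h1' h2'; case/andP: (st) => /eqP e1 _; case/andP: (tu) => /eqP e2 _.
rewrite /strand_letter /strand_x -e2 -e1; case: (s.1) => h1 h2 h1' h2'.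
  have dd' : d = d'.+1 :> nat by have := congr1 val h1; rewrite h2' /= => ->.
  have /famR := klr_braid (T := KW) val X S E j dd'.
  rewrite -[S d' * _ * _ - _]opprB mulNr => ->; rewrite -mulNr; congr (_ * _).
  rewrite /braid_coef -h1' -h2' -h2 eq_inv eq_sym; case: eqP => [e|_] /=; last first.
    by rewrite oppr0.
  rewrite [RHS](braid_poly_inv hp) // -e braid_polyC; by rewrite /braid_poly.
have dd' : d' = d.+1 :> nat by have := congr1 val h2; rewrite h1' /= => ->.
have /famR := klr_braid (T := KW) val X S E j dd'; rewrite mulrBl => ->; congr (_ * _).
by rewrite /braid_coef -h2' -h2 -h1.
Qed.

Local Notation sigma_coef := (sigma_coef X S E).
Local Notation pi_coef := (pi_coef q X E).

(** What is known of two strands at neighbouring positions. *)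
Definition same_sign_adjacent s t := (s.1 == t.1) ==> adjacent s t.

Lemma sigma_coef_same s t : s.1 == t.1 -> sigma_coef s t = cross s t.
Proof. by rewrite /sigma_coef => ->. Qed.

Lemma sigma_coef_E s t j : s.1 != t.1 -> sigma_coef s t * E j = E j * sigma_coef s t.
Proof.
by rewrite /sigma_coef => /negbTE ->; case: s.1; rewrite ?mul1r ?mulr1 //; exact: E_quad.
Qed.

Lemma sigma_coef_strand_x s t z : s.1 != t.1 -> sigma_coef s t * strand_x z =
  strand_x z * sigma_coef s t.
Proof.
rewrite /sigma_coef => /negbTE ->; case: s.1; rewrite ?mul1r ?mulr1 //.
exact/esym/strand_x_quad.
Qed.

Lemma sigma_coef_sqr s t j : same_sign_adjacent s t ->
  sigma_coef s t * (if s.1 == t.1 then sigma_coef s t else sigma_coef t s) * E j =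
  quad_poly (strand_letter s (val j)) (strand_letter t (val j)) (strand_x s) (strand_x
    t) * E j.
Proof.
rewrite /same_sign_adjacent /sigma_coef [t.1 == _]eq_sym; case: eqP => [e st|ne _].
  exact: cross_sqr.
move: ne; case: s.1; case: t.1 => // _; rewrite ?mul1r ?mulr1 ?quadE //.
by rewrite quad_polyC.
Qed.

Lemma sigma_coef_far s t s' t' : same_sign_adjacent s t -> same_sign_adjacent s' t' ->
  s'.2 != s.2 -> s'.2 != t.2 -> t'.2 != s.2 -> t'.2 != t.2 ->
  sigma_coef s t * sigma_coef s' t' = sigma_coef s' t' * sigma_coef s t.
Proof.
rewrite /same_sign_adjacent /sigma_coef => h h' n1 n2 n3 n4.
have SQ u v w x : adjacent u v -> w.2 != u.2 -> w.2 != v.2 -> x.2 != u.2 -> x.2 != v.2 ->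
  cross u v * quad w x = quad w x * cross u v by move=> *; exact: cross_quadfar.
have [e|_] := boolP (s.1 == t.1); have [e'|_] := boolP (s'.1 == t'.1).
- by rewrite e e' in h h'; exact: cross_crossfar.
- by rewrite e in h; case: s'.1; rewrite ?mul1r ?mulr1 // SQ.
- by rewrite e' in h'; case: s.1; rewrite ?mul1r ?mulr1 // SQ // eq_sym.
- by case: s.1; case: s'.1; rewrite ?mul1r ?mulr1 //; exact: quad_quad.
Qed.

Lemma sigma_coef_pi_coeffar s t z : same_sign_adjacent s t -> z.2 != s.2 -> z.2 != t.2 ->
  sigma_coef s t * pi_coef z = pi_coef z * sigma_coef s t.
Proof.
rewrite /same_sign_adjacent /sigma_coef /pi_coef => h n1 n2; case: z.1 n1 n2 => n1 n2;
  first by rewrite mul1r mulr1.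
case: (s.1 == t.1) h => [h|_]; first exact: cross_piquadfar.
by case: s.1; rewrite ?mul1r ?mulr1 //; exact/esym/piquad_quad.
Qed.

(** The strands at three consecutive positions after one sigma, which exchanges
only strands of opposite signs: two strands of the same sign keep their places,
since it is the word of R that changes. *)
Definition swap12 (c : strand m * strand m * strand m) :=
  let: (s, t, u) := c in if s.1 == t.1 then c else (t, s, u).
Definition swap23 (c : strand m * strand m * strand m) :=
  let: (s, t, u) := c in if t.1 == u.1 then c else (s, u, t).
Definition coef12 (c : strand m * strand m * strand m) := sigma_coef c.1.1 c.1.2.
Definition coef23 (c : strand m * strand m * strand m) := sigma_coef c.1.2 c.2.

(** If the three signs agree this is the relation of R. With one odd strand at an
end, the product of the coefficients is symmetric, or all of them are 1. With
the odd strand in the middle, each side has a single quadratic coefficient, on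
different sides of the crossing, and the divided difference appears. *)
Lemma sigma_coef_braid s t u j : same_sign_adjacent s t -> same_sign_adjacent t u ->
  (s.1 != t.1 -> same_sign_adjacent s u) ->
  s.2 != t.2 -> s.2 != u.2 -> t.2 != u.2 ->
  let c := (s, t, u) in
  (coef23 c * coef12 (swap23 c) * coef23 (swap12 (swap23 c))
   - coef12 c * coef23 (swap12 c) * coef12 (swap23 (swap12 c))) * E j =
  (if strand_letter s (val j) != strand_letter u (val j) then 0
   else braid_poly (strand_letter s (val j)) (strand_letter t (val j)) (strand_x s)
     (strand_x t) (strand_x u)) * E j.
Proof.
case: s t u => [[] a] [[] b] [[] c] st tu su n1 n2 n3 cc;
  have ne1 := strand_letter_neq (s := (true, a)) (t := (false, c)) j isT;
  have ne2 := strand_letter_neq (s := (false, a)) (t := (true, c)) j isT;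
  rewrite /cc /coef12 /coef23 /swap12 /swap23 /= /sigma_coef /= ?mul1r ?mulr1.
- exact: cross_braid.
- rewrite ne1 mul0r [quad (_, b) _]quadC [quad (_, a) _]quadC quad_quad.
  by rewrite -[cross _ _ * _ * _]mulrA [_ * quad _ (_, a)]quad_quad cross_quad_quad
    ?subrr ?mul0r // eq_sym.
- rewrite [quad (_, c) _]quadC [quad (_, a) _]quadC mulrBl (cross_quadr (su isT)) //;
  last by rewrite eq_sym.
  rewrite addrAC subrr add0r /same_letter; case: eqP => _; first by rewrite mul1r.
  by rewrite !mul0r.
- by rewrite ne1 mul0r -mulrA cross_quad_quad ?subrr ?mul0r // eq_sym.
- by rewrite ne2 subrr !mul0r.
- rewrite mulrBl (cross_quadl (su isT)) //; last by rewrite eq_sym.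
  rewrite opprB addrCA subrr addr0 /same_letter; case: eqP => _; first by rewrite mul1r.
  by rewrite !mul0r.
- by rewrite ne2 subrr !mul0r.
- exact: cross_braid.
Qed.

Lemma pi_coef_E s j : pi_coef s * E j = E j * pi_coef s.
Proof. by rewrite /pi_coef; case: s.1; rewrite ?mul1r ?mulr1 // E_piquad. Qed.

Lemma pi_coef_strand_x s z : pi_coef s * strand_x z = strand_x z * pi_coef s.
Proof. by rewrite /pi_coef; case: s.1; rewrite ?mul1r ?mulr1 // strand_x_piquad. Qed.

Lemma pi_coef_sqr s j : pi_coef s * pi_coef (strand_opp s) * E j =
  pi_poly q (strand_letter s (val j)) (strand_x s) * E j.
Proof.
by rewrite /pi_coef /=; case: s.1; rewrite /= ?mul1r ?mulr1 ?piquad_opp piquadE.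
Qed.

(** The sign of the correction term in the relation between sigma_1 and pi. *)
Definition pi_braid_poly (a b : I) : R :=
  if ((Iorb_val a)^-1 == Iorb_val b) && (Iorb_val b == q^-1) then 1
  else if ((Iorb_val a)^-1 == Iorb_val b) && (Iorb_val b == q) then -1 else 0.

Definition pair_swap (c : strand m * strand m) :=
  let: (s, t) := c in if s.1 == t.1 then c else (t, s).
Definition pair_flip (c : strand m * strand m) := (strand_opp c.1, c.2).
Definition pair_sigma (c : strand m * strand m) := sigma_coef c.1 c.2.
Definition pair_pi (c : strand m * strand m) := pi_coef c.1.

Lemma pi_braid_polyE s t (j : KW) :
  pi_braid_poly (strand_letter s (val j)) (strand_letter t (val j)) =
  (strand_letter (strand_opp s) (val j) == strand_letter t (val j))%:R *
    - pi_poly_diff q R (strand_letter (strand_opp s) (val j)).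
Proof.
rewrite /pi_braid_poly strand_letter_opp -val_eqE /= /pi_poly_diff.
have := strand_letter_invP s j; set x := strand_letter s (val j); rewrite -val_eqE /= => hx.
have [<-|_] := eqVneq; last by rewrite mul0r.
rewrite mul1r /=; have [e|_] := eqVneq (_ ^-1) q^-1.
  rewrite /= [X in - X]ifF ?opprK //; apply/eqP => e'; move: hx.
  by rewrite -[X in _ != X]invrK e' -[X in X != _]e' e eqxx.
by rewrite /=; case: eqP; rewrite ?oppr0.
Qed.

(** If the signs agree, the product of all the coefficients is symmetric in the two
strands and passes through the crossing. If they differ, the coefficient of one
pi stands on different sides of the crossing in the two products, and the
correction term is its divided difference. *)
Lemma sigma_coef_vv_braid s t j : same_sign_adjacent s t -> (s.1 != t.1 ->
  same_sign_adjacent (strand_opp t) s) ->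
  (s.1 != t.1 -> same_sign_adjacent (strand_opp s) t) -> s.2 != t.2 ->
  let c := (s, t) in
  (pair_sigma c * pair_pi (pair_swap c) * pair_sigma (pair_flip (pair_swap c)) *
    pair_pi (pair_swap (pair_flip (pair_swap c)))
   - pair_pi c * pair_sigma (pair_flip c) * pair_pi (pair_swap (pair_flip c)) *
     pair_sigma (pair_flip (pair_swap (pair_flip c)))) * E j =
  (if s.1 == t.1 then 0 else pi_braid_poly (strand_letter t (val j)) (strand_letter s
    (val j)) * sigma_coef s t) * E j.
Proof.
case: s t => [[] a] [[] b] st ts st' n1 c;
  rewrite /c /pair_sigma /pair_pi /pair_swap /pair_flip /= /strand_opp /= /sigma_coef
    /pi_coef /= ?mul1r ?mulr1 //.
- by rewrite crossC subrr.
- have {}ts : adjacent (true, b) (true, a) := ts isT.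
  have -> : cross (false, a) (false, b) = cross (true, b) (true, a) by rewrite crossC.
  rewrite -(piquad_opp (false, b)) -(piquad_opp (false, a)) /strand_opp /=.
  rewrite [quad (_, a) _]quadC mulrBl
    -[cross _ _ * piquad _ * _ * _]mulrA E_quad mulrA cross_piquadr // mulrDl.
  rewrite -[piquad (true, b) * _ * _ * _]mulrA -E_quad mulrA
    -[piquad _ * _ * quad _ _]mulrA.
  rewrite (cross_quad_opp ts) mulrA [piquad _ * quad _ _]piquad_quad
    -/(strand_opp _) opprD addrA subrr add0r.
  rewrite -[_ * E j * _]mulrA -E_quad (pi_braid_polyE (false, b)) /same_letter.
  by rewrite mulrN !mulNr !mulrA.
- have {}ts : adjacent (false, b) (false, a) := ts isT.
  have -> : cross (true, a) (true, b) = cross (false, b) (false, a) by rewrite crossC.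
  rewrite mulrBl cross_piquadl // addrAC subrr add0r (pi_braid_polyE (true, b))
    /same_letter.
  by rewrite mulrN !mulNr.
- have {}st : adjacent (false, a) (false, b) := st.
  have -> : cross (true, b) (true, a) = cross (false, a) (false, b) by rewrite crossC.
  rewrite -[_ * quad _ _ * piquad _]mulrA -[quad _ _ * _]piquad_quad
    -[cross _ _ * piquad _ * _]mulrA.
  rewrite [piquad _ * (piquad _ * _)]mulrA mulrA cross_piquad_piquad //
    -!mulrA (cross_quad_opp st).
  by rewrite [piquad _ * (quad _ _ * _)]mulrA piquad_quad -!mulrA subrr !mul0r.
Qed.

End StrandRelations.

(** * The matrix representation *)

Section MonomialMatrices.

Variables (R : pzRingType) (P : finType).
Implicit Types (A B : P -> R) (t u : P -> P).

(** The matrix with the single entry A y of row y in column t y. *)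
Definition monomial_mx A t : 'M[R]_#|P| :=
  \matrix_(a, b) (A (enum_val a) *+ (enum_val b == t (enum_val a))).

Lemma monomial_mxM A t B u :
  monomial_mx A t * monomial_mx B u =
    monomial_mx (fun y => A y * B (t y)) (fun y => u (t y)).
Proof.
apply/matrixP => a b; rewrite !mxE (bigD1 (enum_rank (t (enum_val a)))) //=.
rewrite !mxE enum_rankK eqxx mulr1n mulrnAr big1 ?addr0 // => c hc.
rewrite !mxE (_ : enum_val c == _ = false) ?mul0r //; apply/negbTE.
by apply: contraNneq hc => <-; rewrite enum_valK.
Qed.

Lemma monomial_mxD A B t : monomial_mx A t + monomial_mx B t =
  monomial_mx (fun y => A y + B y) t.
Proof. by apply/matrixP => a b; rewrite !mxE mulrnDl. Qed.

Lemma monomial_mxN A t : - monomial_mx A t = monomial_mx (fun y => - A y) t.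
Proof. by apply/matrixP => a b; rewrite !mxE mulNrn. Qed.

Lemma monomial_mxB A B t : monomial_mx A t - monomial_mx B t =
  monomial_mx (fun y => A y - B y) t.
Proof. by rewrite monomial_mxN monomial_mxD. Qed.

Lemma monomial_mx0 t : monomial_mx (fun=> 0) t = 0.
Proof. by apply/matrixP => a b; rewrite !mxE mul0rn. Qed.

Lemma monomial_mx1 : monomial_mx (fun=> 1) id = 1.
Proof. by apply/matrixP => a b; rewrite !mxE (inj_eq enum_val_inj) eq_sym. Qed.

(** The columns may differ in the rows where the entry vanishes: the two sides of
a braid relation move some sign patterns differently. *)
Lemma eq_monomial_mx A t B u : (forall y, A y = B y /\ (t y = u y \/ A y = 0)) ->
  monomial_mx A t = monomial_mx B u.
Proof.
move=> h; apply/matrixP => a b; rewrite !mxE; have [<- [->//|->]] := h (enum_val a).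
by rewrite !mul0rn.
Qed.

Lemma monomial_mx_sum (J : finType) (F : J -> P -> R) t :
  \sum_j monomial_mx (F j) t = monomial_mx (fun y => \sum_j F j y) t.
Proof.
by apply/matrixP => a b; rewrite summxE !mxE -sumrMnl; apply: eq_bigr => j _; rewrite mxE.
Qed.

Local Notation diag A := (monomial_mx A id).

Variables (K : fieldType) (p q lam : K).
Implicit Types (a b : Iorb p lam).

Lemma quad_poly_diag a b A B :
  quad_poly a b (diag A) (diag B) = diag (fun y => quad_poly a b (A y) (B y)).
Proof.
by rewrite /quad_poly; do !case: ifP => _;
  rewrite ?monomial_mx0 ?monomial_mx1 ?monomial_mxB ?monomial_mxM.
Qed.

Lemma braid_poly_diag a b A B (C : P -> R) :
  braid_poly a b (diag A) (diag B) (diag C) =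
    diag (fun y => braid_poly a b (A y) (B y) (C y)).
Proof.
rewrite /braid_poly mulr2n; do !case: ifP => _; rewrite ?monomial_mx0 ?monomial_mx1 //.
  by rewrite monomial_mxD !monomial_mxB.
by rewrite -monomial_mx1 monomial_mxN.
Qed.

Lemma pi_poly_diag a A : pi_poly q a (diag A) = diag (fun y => pi_poly q a (A y)).
Proof. by rewrite /pi_poly; do !case: ifP => _; rewrite ?monomial_mxN ?monomial_mx1. Qed.

End MonomialMatrices.

Section StrandsUnderMoves.

Variable m : nat.
Local Notation P := {ffun 'I_m -> bool}.
Implicit Types (eps : P) (k : 'I_m.-1).

Lemma swap_sign_far (k k' : 'I_m.-1) eps : (k.+1 < k')%N || (k'.+1 < k)%N ->
  swap_sign k (swap_sign k' eps) = swap_sign k' (swap_sign k eps).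
Proof.
move=> kk; suff e : commute (tperm (lo k) (hi k)) (tperm (lo k') (hi k')).
  by apply/ffunP => l; rewrite !ffunE /swap_pos -!permM e.
apply: perm_onC (tperm_on _ _) (tperm_on _ _) _.
rewrite disjoints_subset; apply/subsetP => a.
by rewrite !inE -!val_eqE /=; lia.
Qed.

Lemma hi_lo (k k' : 'I_m.-1) : k' = k.+1 :> nat -> hi k = lo k'.
Proof. by move=> e; apply/val_inj; rewrite /= e. Qed.

Definition triple_at k k' eps : strand m * strand m * strand m :=
  (strand_at eps (lo k), strand_at eps (hi k), strand_at eps (hi k')).

Definition pair_at k eps : strand m * strand m :=
  (strand_at eps (lo k), strand_at eps (hi k)).

Lemma triple_at_swap12 k k' eps : k' = k.+1 :> nat ->
  triple_at k k' (swap_sign k eps) = swap12 (triple_at k k' eps).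
Proof.
move=> kk; rewrite /triple_at /=; case: eqP => [e|/eqP e]; first by rewrite swap_sign_same.
rewrite !strand_at_swap_sign // swap_pos_lo swap_pos_hi /swap_pos tpermD //
  -val_eqE /=; lia.
Qed.

Lemma triple_at_swap23 k k' eps : k' = k.+1 :> nat ->
  triple_at k k' (swap_sign k' eps) = swap23 (triple_at k k' eps).
Proof.
move=> kk; rewrite /triple_at /= (hi_lo kk); case: eqP => [e|/eqP e];
  first by rewrite swap_sign_same.
rewrite !strand_at_swap_sign // swap_pos_lo swap_pos_hi /swap_pos tpermD //
  -val_eqE /=; lia.
Qed.

Lemma pair_at_swap_sign k eps : pair_at k (swap_sign k eps) = pair_swap (pair_at k eps).
Proof.
rewrite /pair_at /=; case: eqP => [e|/eqP e]; first by rewrite swap_sign_same.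
by rewrite !strand_at_swap_sign // swap_pos_lo swap_pos_hi.
Qed.

Lemma pair_at_flip_sign k eps : k = 0%N :> nat -> pair_at k (flip_sign eps) =
  pair_flip (pair_at k eps).
Proof. by move=> k0; rewrite /pair_at !strand_at_flip_sign /= k0. Qed.

Lemma same_sign_adjacent_at k eps :
  same_sign_adjacent (strand_at eps (lo k)) (strand_at eps (hi k)).
Proof. by apply/implyP => /eqP; exact: adjacent_strand_at. Qed.

Lemma swap_sign_rev k k' eps : k' = k.+1 :> nat ->
  let r := [ffun l => eps (tperm (lo k) (hi k') l)] in
  swap_sign k' (swap_sign k (swap_sign k' eps)) =
    r /\ swap_sign k (swap_sign k' (swap_sign k eps)) = r.
Proof.
move=> kk; have hl := hi_lo kk; pose a := lo k; pose b := hi k; pose c := hi k'.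
have ab : a != b by exact: lo_neq_hi.
have bc : b != c by rewrite /b hl; exact: lo_neq_hi.
have ac : a != c by rewrite -val_eqE /=; lia.
have conj x y (s : 'S_m) : (s^-1 = s -> s * tperm x y * s = tperm (s x) (s y))%g.
  by move=> sV; rewrite -tpermJ conjgE sV mulgA.
split; apply/ffunP => l; rewrite !ffunE /swap_pos -hl -!permM -/a -/b
  -/c mulgA conj ?tpermV //.
  by rewrite tpermL [tperm b c a]tpermD 1?eq_sym.
by rewrite tpermR [tperm a b c]tpermD.
Qed.

Lemma swap_sign_rev_id k k' eps : k' = k.+1 :> nat -> eps (lo k) = eps (hi k') ->
  swap_sign k' (swap_sign k (swap_sign k' eps)) = eps.
Proof.
move=> kk e; have [-> _] := swap_sign_rev eps kk.
by apply/ffunP => l; rewrite ffunE; case: tpermP => // ->.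
Qed.

Lemma strand_at_swap_sign_far k eps l : l != lo k -> l != hi k ->
  strand_at (swap_sign k eps) l = strand_at eps l.
Proof.
move=> h1 h2; have [e|e] := eqVneq (eps (lo k)) (eps (hi k));
  first by rewrite swap_sign_same.
by rewrite strand_at_swap_sign // /swap_pos tpermD // eq_sym.
Qed.

Lemma flip_sign_swap_sign_flip_sign k eps : k = 0%N :> nat ->
  flip_sign (swap_sign k (flip_sign (swap_sign k eps))) =
    swap_sign k (flip_sign (swap_sign k (flip_sign eps))) /\
  (eps (lo k) != eps (hi k) -> flip_sign (swap_sign k (flip_sign (swap_sign k eps))) =
    swap_sign k eps).
Proof.
move=> k0.
have hb (l : 'I_m) : [\/ l = lo k, l = hi k | (l != lo k) && (l != hi k)].
  have [->|h1] := eqVneq l (lo k); first by constructor 1.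
  by have [->|h2] := eqVneq l (hi k); [constructor 2 | constructor 3].
have lo0 : (lo k : nat) == 0%N by rewrite /= k0.
split; last move=> ne; apply/ffunP => l; have [->|->|/andP[h1 h2]] := hb l;
  rewrite !(ffunE, swap_pos_lo, swap_pos_hi) ?lo0 /= ?k0 //=;
  rewrite ?(ffunE, swap_pos_lo, swap_pos_hi) ?lo0 /= ?k0 //=.
- have st : swap_pos k l = l by rewrite /swap_pos tpermD // eq_sym.
  by rewrite !(ffunE, st).
- by move: ne; case: (eps (lo k)); case: (eps (hi k)).
- by move: ne; case: (eps (lo k)); case: (eps (hi k)).
- have st : swap_pos k l = l by rewrite /swap_pos tpermD // eq_sym.
  have l0 : (l : nat) == 0%N = false by apply/negbTE; move: h1; rewrite -val_eqE /= k0.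
  by rewrite !(ffunE, st, l0).
Qed.

Lemma flip_sign_swap_sign_far k eps : k != 0%N :> nat -> flip_sign (swap_sign k eps) =
  swap_sign k (flip_sign eps).
Proof.
move=> k0; apply/ffunP => l; rewrite !ffunE /swap_pos.
case: tpermP => [->|->|_ _] /=; first by rewrite (negbTE k0).
  by rewrite (negbTE k0).
by [].
Qed.

End StrandsUnderMoves.

Section VVMatrices.

Variables (K : fieldType) (p q lam : K) (m : nat).
Variables nu nut : {mset Iorb p lam}%mset.
Hypothesis hp : p != 0.
Hypothesis hnut : nu = (nut `+` mset_inv nut)%mset.
Hypothesis hsum : forall i : Iorb p lam,
     ~~ ((1 <= nut i)%N && (1 <= nut (Iinv i))%N).
Local Notation I := (Iorb p lam).
Local Notation KW := (klr_word m nut).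
Local Notation VW := (vv_word m nu).
Local Notation P := {ffun 'I_m -> bool}.
Implicit Types (eps : P) (j : KW) (i : VW).

Lemma folded_subproof eps j : vv_weight (fold_word eps (val j)) == nu.
Proof. by rewrite vv_weight_fold_word vv_weight_klr (eqP (valP j)) hnut. Qed.
Definition folded eps j : VW := Sub (fold_word eps (val j)) (folded_subproof eps j).

Lemma folded_eq eps j i : (folded eps j == i) = (fold_word eps (val j) == val i).
Proof. by rewrite -val_eqE. Qed.

Lemma tnth_folded eps j l : tnth (val (folded eps j)) l =
  strand_letter (strand_at eps l) (val j).
Proof. exact: tnth_fold_word. Qed.

Variables (R : pzRingType) (X : 'I_m -> R) (S : 'I_m.-1 -> R) (E : KW -> R).
Hypothesis famR : klr_family (T := KW) val X S E.

Local Notation strand_x := (strand_x X).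
Local Notation cross := (cross S).
Local Notation sigma_coef := (sigma_coef X S E).
Local Notation pi_coef := (pi_coef q X E).

Definition x_entry l eps : R := strand_x (strand_at eps l).
Definition sigma_entry k eps : R := sigma_coef (strand_at eps (lo k)) (strand_at eps
  (hi k)).
Definition pi_entry (h : (0 < m)%N) eps : R := pi_coef (strand_at eps (Ordinal h)).
Definition e_entry i eps : R := \sum_(j : KW | folded eps j == i) E j.

Definition x_mx l := monomial_mx (x_entry l) id.
Definition sigma_mx k := monomial_mx (sigma_entry k) (@swap_sign m k).
Definition pi_mx h := monomial_mx (pi_entry h) (@flip_sign m).
Definition e_mx i := monomial_mx (e_entry i) id.

(** Relations of W hold after multiplication by an idempotent e(i); here they
become identities of R on the components of the words that fold to i. *)
Lemma monomial_mx_e (A B : P -> R) t u i :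
  (forall eps, (t eps = u eps /\
       (forall j, folded (t eps) j = i -> A eps * E j = B eps * E j))
    \/ A eps = 0 /\ (forall j, folded (u eps) j = i -> B eps * E j = 0)) ->
  monomial_mx A t * e_mx i = monomial_mx B u * e_mx i.
Proof.
move=> h; rewrite !monomial_mxM; apply: eq_monomial_mx => eps; rewrite /e_entry !mulr_sumr.
have [[<- hA]|[-> hB]] := h eps.
  by split; [apply: eq_bigr => j /eqP; exact: hA | left].
have e0 : \sum_(j | folded (t eps) j == i) 0 * E j = 0 by rewrite big1 // => j;
  rewrite mul0r.
by rewrite e0 big1 => [|j /eqP]; [split=> //; right | exact: hB].
Qed.

Lemma x_entry_E l eps j : x_entry l eps * E j = E j * x_entry l eps.
Proof. exact: strand_xE famR _ _. Qed.

Lemma fold_swap_strands k eps j : eps (lo k) = eps (hi k) ->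
  fold_word eps (val (swap_strands (strand_at eps (lo k)) (strand_at eps (hi k)) j)) =
  swap_word k (fold_word eps (val j)).
Proof.
move=> e; have st := adjacent_strand_at e; apply: eq_from_tnth => l.
rewrite [RHS]tnth_mktuple !tnth_fold_word; case: tpermP => [->|->|/eqP h1 /eqP h2].
- exact: (strand_letter_swapl st).
- exact: (strand_letter_swapr st).
- by apply: (strand_letter_swap st); exact: strand_at_inj.
Qed.

Lemma eq_swap_word k (w w' : m.-tuple I) :
  (swap_word k w == w') = (w == swap_word k w').
Proof. by apply/eqP/eqP => [<-|->]; rewrite swap_wordK. Qed.

Lemma eq_flip_word (w w' : m.-tuple I) : (flip_word w == w') = (w == flip_word w').
Proof.
have fK : involutive (@flip_word K p lam m).
  by move=> v; apply: eq_from_tnth => l; rewrite !tnth_mktuple; case: eqP => // _;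
    rewrite IinvK.
by apply/eqP/eqP => [<-|->]; rewrite fK.
Qed.

Lemma sigma_entry_e_entry k (i i' : VW) eps : val i' = swap_word k (val i) ->
  sigma_entry k eps * e_entry i (swap_sign k eps) = e_entry i' eps * sigma_entry k eps.
Proof.
move=> ii; rewrite /e_entry mulr_sumr mulr_suml.
case: (boolP (eps (lo k) == eps (hi k))) => [e|e].
  have st := adjacent_strand_at (eqP e); rewrite swap_sign_same ?(eqP e) //.
  have sI : injective (swap_strands (nut := nut) (strand_at eps (lo k)) (strand_at eps
    (hi k))).
    exact/inv_inj/swap_strandsK.
  rewrite /sigma_entry sigma_coef_same // [RHS](reindex_inj sI) /=.
  apply: eq_big => j; last by rewrite (cross_E famR st).
  by rewrite !folded_eq fold_swap_strands ?(eqP e) // ii eq_swap_word swap_wordK.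
apply: eq_big => j; last by rewrite (sigma_coef_E famR).
by rewrite !folded_eq ii fold_swap_sign // eq_swap_word.
Qed.

Lemma pi_entry_e_entry h (i i' : VW) eps : val i' = flip_word (val i) ->
  pi_entry h eps * e_entry i (flip_sign eps) = e_entry i' eps * pi_entry h eps.
Proof.
move=> ii; rewrite /e_entry mulr_sumr mulr_suml.
apply: eq_big => j; last by rewrite (pi_coef_E _ famR).
by rewrite !folded_eq ii fold_flip_sign // eq_flip_word.
Qed.

Lemma e_entry_E i eps j : e_entry i eps * E j = if folded eps j == i then E j else 0.
Proof.
rewrite /e_entry mulr_suml; case: ifP => ji.
  rewrite (bigD1 j) //= (klrEE famR) eqxx big1 ?addr0 // => j' /andP[_ jj].
  by rewrite (klrEE famR) (negbTE jj).
rewrite big1 // => j' jj; rewrite (klrEE famR); case: eqP => // e.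
by rewrite e ji in jj.
Qed.

Lemma sigma_entry_sqr k eps j : sigma_entry k eps * sigma_entry k (swap_sign k eps) * E j =
  quad_poly (tnth (val (folded eps j)) (lo k)) (tnth (val (folded eps j)) (hi k))
    (x_entry (lo k) eps) (x_entry (hi k) eps) * E j.
Proof.
rewrite !tnth_folded /x_entry -(sigma_coef_sqr hp famR j (same_sign_adjacent_at k eps)).
congr (_ * _ * _); rewrite /sigma_entry; case: ifP => [/eqP e|/negbT e].
  by rewrite swap_sign_same.
by rewrite !strand_at_swap_sign // swap_pos_lo swap_pos_hi.
Qed.

Lemma sigma_entry_far (k k' : 'I_m.-1) eps : (k.+1 < k')%N || (k'.+1 < k)%N ->
  sigma_entry k eps * sigma_entry k' (swap_sign k eps) =
    sigma_entry k' eps * sigma_entry k (swap_sign k' eps).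
Proof.
move=> kk; rewrite /sigma_entry !strand_at_swap_sign_far -?val_eqE /=; try lia.
by apply: (sigma_coef_far famR) (same_sign_adjacent_at _ _) (same_sign_adjacent_at _ _)
  _ _ _ _;
  apply: strand_at_inj; rewrite -val_eqE /=; lia.
Qed.

Lemma sigma_entry_braid (k k' : 'I_m.-1) eps j : k' = k.+1 :> nat ->
  (sigma_entry k' eps * sigma_entry k (swap_sign k' eps) * sigma_entry k' (swap_sign k
    (swap_sign k' eps))
   - sigma_entry k eps * sigma_entry k' (swap_sign k eps) * sigma_entry k (swap_sign k'
     (swap_sign k eps))) * E j =
  (if strand_letter (strand_at eps (lo k)) (val j) != strand_letter (strand_at eps (hi
    k')) (val j) then 0
   else braid_poly (strand_letter (strand_at eps (lo k)) (val j)) (strand_letter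
     (strand_at eps (hi k)) (val j))
     (x_entry (lo k) eps) (x_entry (hi k) eps) (x_entry (hi k') eps)) * E j.
Proof.
move=> kk; have hl := hi_lo kk.
have st := same_sign_adjacent_at k eps; have tu := same_sign_adjacent_at k' eps;
  rewrite -hl in tu.
have su : (strand_at eps (lo k)).1 != (strand_at eps (hi k)).1 ->
    same_sign_adjacent (strand_at eps (lo k)) (strand_at eps (hi k')).
  move=> e; have := same_sign_adjacent_at k' (swap_sign k eps).
  by rewrite -hl strand_at_swap_sign // swap_pos_hi strand_at_swap_sign_far //
    -val_eqE /=; lia.
rewrite -(sigma_coef_braid hp hsum famR j st tu su); try (apply: strand_at_inj;
  rewrite -val_eqE /=; lia).
congr (_ * _); rewrite -/(triple_at k k' eps) -!triple_at_swap23 //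
  -!triple_at_swap12 // -!triple_at_swap23 //.
by rewrite /coef12 /coef23 /sigma_entry /triple_at /= hl.
Qed.

Lemma sigma_entry_x k l eps :
  if eps (lo k) == eps (hi k) then forall j,
    (sigma_entry k eps * x_entry l eps
      - x_entry (swap_pos k l) eps * sigma_entry k eps) * E j =
    demazure_coef (T := VW) val R k l (folded eps j) * E j
  else sigma_entry k eps * x_entry l (swap_sign k eps)
    - x_entry (swap_pos k l) eps * sigma_entry k eps = 0.
Proof.
case: ifP => e; last first.
  by rewrite /sigma_entry /x_entry strand_at_swap_sign ?e //
    (sigma_coef_strand_x famR) ?subrr //= e.
have st := adjacent_strand_at (eqP e); move=> j.
rewrite /sigma_entry sigma_coef_same // /demazure_coef !tnth_folded mulrBl /x_entry.
have [->|h1] := eqVneq l (lo k).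
  rewrite swap_pos_lo (cross_xl famR st) addrAC subrr add0r /same_letter.
  by case: eqP => _ /=; rewrite ?mul1r ?mulN1r ?mul0r ?oppr0.
have [->|h2] := eqVneq l (hi k).
  rewrite swap_pos_hi (cross_xr famR st) addrAC subrr add0r /same_letter.
  by case: eqP => _ /=; rewrite ?mul1r ?mulN1r ?mul0r ?oppr0.
rewrite if_same mul0r /swap_pos tpermD 1?eq_sym // (cross_xfar famR st) ?subrr //;
  exact: strand_at_inj.
Qed.

Lemma sigma_entry_vv_braid (h : (0 < m)%N) (k : 'I_m.-1) eps j : k = 0%N :> nat ->
  (sigma_entry k eps * pi_entry h (swap_sign k eps) * (sigma_entry k (flip_sign
    (swap_sign k eps))
     * pi_entry h (swap_sign k (flip_sign (swap_sign k eps))))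
   - pi_entry h eps * sigma_entry k (flip_sign eps) * (pi_entry h (swap_sign k
     (flip_sign eps))
     * sigma_entry k (flip_sign (swap_sign k (flip_sign eps))))) * E j =
  (if eps (lo k) == eps (hi k) then 0
   else pi_braid_poly q R (strand_letter (strand_at eps (hi k)) (val j)) (strand_letter
     (strand_at eps (lo k)) (val j))
      * sigma_entry k eps) * E j.
Proof.
move=> k0; have st := same_sign_adjacent_at k eps.
have lo0 : Ordinal h = lo k by apply/val_inj; rewrite /= k0.
have fl y : strand_at (flip_sign y) (lo k) = strand_opp (strand_at y (lo k)).
  by rewrite strand_at_flip_sign /= k0.
have fh y : strand_at (flip_sign y) (hi k) = strand_at y (hi k).
  by rewrite strand_at_flip_sign /=.
have ts : (strand_at eps (lo k)).1 != (strand_at eps (hi k)).1 ->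
    same_sign_adjacent (strand_opp (strand_at eps (hi k))) (strand_at eps (lo k)).
  move=> e; have := same_sign_adjacent_at k (flip_sign (swap_sign k eps)).
  by rewrite fl fh !strand_at_swap_sign // swap_pos_lo swap_pos_hi.
have st' : (strand_at eps (lo k)).1 != (strand_at eps (hi k)).1 ->
    same_sign_adjacent (strand_opp (strand_at eps (lo k))) (strand_at eps (hi k)).
  by move=> _; have := same_sign_adjacent_at k (flip_sign eps); rewrite fl fh.
rewrite -(sigma_coef_vv_braid q hp hsum famR j st ts st');
  last exact/strand_at_inj/lo_neq_hi.
rewrite /pi_entry lo0 !mulrA; congr (_ * _); rewrite -/(pair_at k eps).
rewrite -!pair_at_swap_sign -!pair_at_flip_sign //
  -!pair_at_swap_sign -!pair_at_flip_sign // -!pair_at_swap_sign -?pair_at_flip_sign //.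
Qed.

Lemma vv_matrices : vv_family q (T := VW) val x_mx sigma_mx pi_mx e_mx.
Proof.
move=> _ _ [_ _ [i i'|k i i' ii|l i||l l'|k i|k k' kk|k k' i kk|k l i]|h i i' ii|h i|h
  l|h k i k0|h k k0].
- rewrite monomial_mxM; have [<-|ne] := eqVneq i i'.
    apply: eq_monomial_mx => eps; split; last by left.
    by rewrite [X in _ * X]/e_entry mulr_sumr; apply: eq_bigr => j ji; rewrite e_entry_E ji.
  rewrite -(monomial_mx0 _ id); apply: eq_monomial_mx => eps; split; last by left.
  rewrite [X in _ * X]/e_entry mulr_sumr big1 // => j /eqP ji.
  by rewrite e_entry_E ji eq_sym (negbTE ne).
- by rewrite !monomial_mxM; apply: eq_monomial_mx => eps; split;
  [exact: sigma_entry_e_entry | left].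
- rewrite !monomial_mxM; apply: eq_monomial_mx => eps; split; last by left.
  by rewrite /e_entry mulr_sumr mulr_suml; apply: eq_bigr => j _; exact: x_entry_E.
- rewrite monomial_mx_sum -monomial_mx1; apply: eq_monomial_mx => eps; split; last by left.
  rewrite -(klrE1 famR) (exchange_big_dep xpredT) //=; apply: eq_bigr => j _.
  by rewrite (eq_bigl (pred1 (folded eps j))) ?big_pred1_eq // => i; rewrite eq_sym.
- by rewrite !monomial_mxM; apply: eq_monomial_mx => eps; split;
  [exact: strand_xC famR _ _ | left].
- rewrite expr2 monomial_mxM [quad_coef _ _ _ _](quad_poly_diag _ _ (x_entry (lo k))
  (x_entry (hi k))).
  apply: monomial_mx_e => eps; left; rewrite swap_signK; split=> // j <-;
    exact: sigma_entry_sqr.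
- rewrite !monomial_mxM; apply: eq_monomial_mx => eps; split; first exact: sigma_entry_far.
  by left; rewrite swap_sign_far // orbC.
- rewrite !monomial_mxM.
  have -> (C : P -> R) : monomial_mx C (fun y => swap_sign k (swap_sign k' (swap_sign k
    y))) =
      monomial_mx C (fun y => swap_sign k' (swap_sign k (swap_sign k' y))).
    apply: eq_monomial_mx => eps; split=> //; left.
    by have [-> ->] := swap_sign_rev eps kk.
  rewrite monomial_mxB.
  have -> : braid_coef (T := VW) val x_mx k k' i = monomial_mx (fun eps =>
      if tnth (val i) (lo k) != tnth (val i) (hi k') then 0
      else braid_poly (tnth (val i) (lo k)) (tnth (val i) (hi k))
           (x_entry (lo k) eps) (x_entry (hi k) eps) (x_entry (hi k') eps)) id.
    rewrite /braid_coef; case: ifP => _; first by rewrite monomial_mx0.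
    by rewrite -(braid_poly_diag _ _ (x_entry (lo k)) (x_entry (hi k)) (x_entry (hi k'))).
  apply: monomial_mx_e => eps; have [e|e] := eqVneq (eps (lo k)) (eps (hi k')).
    by left; rewrite swap_sign_rev_id //; split=> // j <-;
      rewrite !tnth_folded sigma_entry_braid.
  right; split.
    by apply: (eq_klr_mulE famR) => j;
      rewrite sigma_entry_braid // (strand_letter_neq hsum) ?mul0r.
  by move=> j <-; rewrite !tnth_folded (strand_letter_neq hsum) ?mul0r.
- have -> : demazure_coef (T := VW) val 'M[R]_#|P| k l i =
      monomial_mx (fun=> demazure_coef (T := VW) val R k l i) id.
    by rewrite /demazure_coef; do !case: ifP => _;
      rewrite ?monomial_mx0 -?monomial_mx1 ?monomial_mxN.
  rewrite [sigma_mx k * _]monomial_mxM [_ * sigma_mx k]monomial_mxM monomial_mxB;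
    apply: monomial_mx_e => eps; have := sigma_entry_x k l eps.
  case: eqP => [e h|/eqP e h]; first by left; rewrite swap_sign_same //; split=> // j <-.
  right; split=> // j <-; rewrite /demazure_coef !tnth_folded (strand_letter_neq hsum)
    ?mul0r //.
- by rewrite !monomial_mxM; apply: eq_monomial_mx => eps; split;
  [exact: pi_entry_e_entry | left].
- rewrite expr2 monomial_mxM [pi_quad_coef _ _ _ _ _](pi_poly_diag q _ (x_entry
  (Ordinal h))).
  apply: monomial_mx_e => eps; left; rewrite flip_signK; split=> // j <-.
  by rewrite tnth_folded /pi_entry strand_at_flip_sign /= (pi_coef_sqr q hsum famR).
- rewrite !monomial_mxM; have hx eps : pi_entry h eps * x_entry l (flip_sign eps) =
      (if l == 0%N :> nat then - (x_entry l eps * pi_entry h eps) else x_entry l eps *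
        pi_entry h eps).
    rewrite /x_entry strand_at_flip_sign; case: ifP => _;
      rewrite ?strand_x_opp ?mulrN (pi_coef_strand_x _ famR) //.
  case: (l == 0%N :> nat) hx => hx; rewrite ?monomial_mxN; apply: eq_monomial_mx => eps;
    by split; [exact: hx | left].
- have -> : pi_braid_term q (T := VW) val sigma_mx e_mx k i =
    monomial_mx (fun eps => pi_braid_poly q R (tnth (val i) (lo k)) (tnth (val i) (hi
      k)) * sigma_entry k eps)
       (swap_sign k) * e_mx i.
    rewrite /pi_braid_term /pi_braid_poly; case: ifP => _.
      by congr (_ * _); apply: eq_monomial_mx => eps; rewrite mul1r; split=> //; left.
    case: ifP => _.
      rewrite -mulNr monomial_mxN; congr (_ * _); apply: eq_monomial_mx => eps.
      by rewrite mulN1r; split=> //; left.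
    rewrite (_ : monomial_mx _ _ = 0) ?mul0r // -(monomial_mx0 _ id);
      apply: eq_monomial_mx => eps.
    by rewrite mul0r; split=> //; right.
  have -> : (sigma_mx k * pi_mx h) ^+ 2 = monomial_mx (fun eps =>
      sigma_entry k eps * pi_entry h (swap_sign k eps) * (sigma_entry k (flip_sign
        (swap_sign k eps))
     * pi_entry h (swap_sign k (flip_sign (swap_sign k eps))))) (fun y => flip_sign
       (swap_sign k (flip_sign (swap_sign k y)))).
    by rewrite expr2 !monomial_mxM.
  have -> : (pi_mx h * sigma_mx k) ^+ 2 = monomial_mx (fun eps =>
      pi_entry h eps * sigma_entry k (flip_sign eps) * (pi_entry h (swap_sign k
        (flip_sign eps))
     * sigma_entry k (flip_sign (swap_sign k (flip_sign eps))))) (fun y => flip_sign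
       (swap_sign k (flip_sign (swap_sign k y)))).
    rewrite expr2 !monomial_mxM; apply: eq_monomial_mx => eps; split=> //; left.
    by have [->] := flip_sign_swap_sign_flip_sign eps k0.
  rewrite monomial_mxB; apply: monomial_mx_e => eps;
    have [_ ht] := flip_sign_swap_sign_flip_sign eps k0.
  have [e|e] := eqVneq (eps (lo k)) (eps (hi k)).
    right; split.
      by apply: (eq_klr_mulE famR) => j; rewrite sigma_entry_vv_braid // e eqxx.
    move=> j <-; rewrite swap_sign_same // !tnth_folded (pi_braid_polyE q hsum).
    by rewrite (negbTE (strand_letter_neq hsum j _)) ?mul0r //= e; case: (eps _).
  left; rewrite ht //; split=> // j <-.
  by rewrite sigma_entry_vv_braid // (negbTE e) !tnth_folded !strand_at_swap_sign //
    swap_pos_lo swap_pos_hi.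
- rewrite !monomial_mxM; apply: eq_monomial_mx => eps; split; last by left;
  rewrite flip_sign_swap_sign_far.
  rewrite /sigma_entry /pi_entry !strand_at_flip_sign /= (negbTE k0)
    strand_at_swap_sign_far -?val_eqE /=; try lia.
  by rewrite (sigma_coef_pi_coeffar q famR) ?same_sign_adjacent_at //;
    apply: strand_at_inj; rewrite -val_eqE /=; lia.
Qed.

End VVMatrices.

(** * Transporting the corner to every sign pattern *)

Section Moves.

Variable m : nat.
Local Notation P := {ffun 'I_m -> bool}.
Implicit Types (eps : P) (k : 'I_m.-1).

Definition all_pos : P := [ffun=> false].

Lemma strand_rank0 l : strand_rank all_pos l = l.
Proof.
apply/val_inj; rewrite /= /nat_rank.
rewrite (eq_card (B := [pred a : 'I_m | (a < l)%N])) => [|a]; last first.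
  by rewrite !inE /before !ffunE.
rewrite -sum1_card -(big_ord_widen m (fun=> 1%N)) 1?ltnW //.
by rewrite sum_nat_const card_ord muln1.
Qed.

Lemma strand_at0 l : strand_at all_pos l = (false, l).
Proof. by rewrite /strand_at strand_rank0 ffunE. Qed.

Lemma swap_sign_at_far k eps l : l != lo k -> l != hi k -> swap_sign k eps l = eps l.
Proof. by move=> h1 h2; rewrite ffunE /swap_pos tpermD // eq_sym. Qed.

Lemma pos_neq (k k' : 'I_m.-1) : k' = k.+1 :> nat ->
  [/\ hi k' != lo k, hi k' != hi k, lo k != lo k' & lo k != hi k'].
Proof. by move=> kk; split; rewrite -val_eqE /=; lia. Qed.

Inductive sign_move := Mpi of (0 < m)%N | Msig of 'I_m.-1.

Definition act_move (g : sign_move) eps : P :=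
  match g with Mpi _ => flip_sign eps | Msig k => swap_sign k eps end.

(** g is a possible last move on a path to eps. *)
Definition descends (g : sign_move) eps : bool :=
  match g with
  | Mpi h => eps (Ordinal h)
  | Msig k => ~~ eps (lo k) && eps (hi k)
  end.

(** The length of a path of moves from the all-positive pattern. *)
Definition height eps : nat := \sum_l eps l * l.+1.

Lemma height_act_move g eps : descends g eps -> (height (act_move g eps) < height eps)%N.
Proof.
case: g => [h /= e|k /= /andP[e1 e2]]; rewrite /height.
  rewrite (bigD1 (Ordinal h)) //= [X in (_ < X)%N](bigD1 (Ordinal h)) //= !ffunE /= e.
  rewrite mul0n mul1n add0n add1n ltnS; apply: leq_sum => l l0.
  by rewrite ffunE ifF //; apply/negbTE.
rewrite (reindex_inj (inv_inj (swap_posK k))) /= (bigD1 (hi k)) //=.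
rewrite [X in (_ < X)%N](bigD1 (hi k)) //= ffunE swap_posK swap_pos_hi e2 !mul1n -addSn.
apply: leq_add => //; apply: leq_sum => l lh; rewrite ffunE swap_posK /swap_pos.
by case: tpermP lh => [->|->|_ _ _] //; rewrite ?eqxx ?(negbTE e1).
Qed.

Lemma descendsP eps : eps = all_pos \/ exists g, descends g eps.
Proof.
case: (pickP eps) => [l0 e0|e]; last first.
  by left; apply/ffunP => l; rewrite ffunE; exact: e.
right; have [l el ml] := arg_minnP (fun l : 'I_m => l : nat) e0.
have hm : (0 < m)%N by case: l {el ml} => l; case: (m).
case: l el ml => [[|l] hl] el ml.
  by exists (Mpi hm); rewrite /= (_ : Ordinal hm = Ordinal hl) //; exact: val_inj.
have hk : (l < m.-1)%N by lia.
exists (Msig (Ordinal hk)); rewrite /= (_ : hi _ = Ordinal hl); last exact: val_inj.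
by rewrite el andbT; apply/negP => /ml /=; rewrite ltnn.
Qed.

Lemma descends0 g : descends g all_pos = false.
Proof. by case: g => [h|k]; rewrite /= !ffunE. Qed.

End Moves.

Section Transport.

Variables (K : fieldType) (p q lam : K) (m : nat).
Variables nu nut : {mset Iorb p lam}%mset.
Hypothesis hnut : nu = (nut `+` mset_inv nut)%mset.
Hypothesis hsum : forall i : Iorb p lam,
     ~~ ((1 <= nut i)%N && (1 <= nut (Iinv i))%N).
Local Notation I := (Iorb p lam).
Local Notation KW := (klr_word m nut).
Local Notation VW := (vv_word m nu).
Local Notation P := {ffun 'I_m -> bool}.
Implicit Types (eps : P) (j : KW) (i : VW) (k : 'I_m.-1).

Variables (R : pzRingType) (X : 'I_m -> R) (S : 'I_m.-1 -> R) (E : KW -> R).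
Hypothesis famR : klr_family (T := KW) val X S E.

Variables (W : pzRingType) (x : 'I_m -> W) (sg : 'I_m.-1 -> W).
Variables (pi : (0 < m)%N -> W) (e : VW -> W).
Hypothesis famW : vv_family q (T := VW) val x sg pi e.

Local Notation folded := (folded hnut).
Local Notation inc := (folded (@all_pos m)).

Definition pos_idem : W := \sum_(j : KW) e (inc j).

Variable kap : {additive R -> W}.
Hypothesis kapM : {morph kap : a b / a * b}.
Hypothesis kap1 : kap 1 = pos_idem.
Hypothesis kapX : forall l, kap (X l) = x l * pos_idem.
Hypothesis kapS : forall k, kap (S k) = sg k * pos_idem.
Hypothesis kapE : forall j, kap (E j) = e (inc j).

Lemma vvEE i i' : e i * e i' = if i == i' then e i else 0.
Proof. exact/famW/vv_klr/klr_ee. Qed.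
Lemma vvXE l i : x l * e i = e i * x l.
Proof. exact/famW/vv_klr/klr_xe. Qed.
Lemma vvSE k i i' : val i' = swap_word k (val i) -> sg k * e i = e i' * sg k.
Proof. by move=> ii; exact/famW/vv_klr/klr_se. Qed.
Lemma vvPE h i i' : val i' = flip_word (val i) -> pi h * e i = e i' * pi h.
Proof. by move=> ii; exact/famW/vv_pe. Qed.

Lemma vvSX k l i : (sg k * x l - x (swap_pos k l) * sg k) * e i =
  demazure_coef (T := VW) val W k l i * e i.
Proof. exact/famW/vv_klr/klr_sx. Qed.
Lemma vvSS k i : sg k ^+ 2 * e i = quad_coef (T := VW) val x k i * e i.
Proof. exact/famW/vv_klr/klr_quad. Qed.
Lemma vvSSS k k' i : k' = k.+1 :> nat ->
  (sg k' * sg k * sg k' - sg k * sg k' * sg k) * e i =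
  braid_coef (T := VW) val x k k' i * e i.
Proof. by move=> kk; exact/famW/vv_klr/klr_braid. Qed.
Lemma vvPP h i : pi h ^+ 2 * e i = pi_quad_coef q (T := VW) val x h i * e i.
Proof. exact/famW/vv_quad. Qed.
Lemma vvPS h k i : k = 0%N :> nat ->
  ((sg k * pi h) ^+ 2 - (pi h * sg k) ^+ 2) * e i = pi_braid_term q (T := VW) val sg e k i.
Proof. by move=> k0; exact/famW/vv_braid. Qed.

Definition gen_move (g : sign_move m) : W :=
  match g with Mpi h => pi h | Msig k => sg k end.

(** transport eps y says that y is a product T_eps of generators along a path
of moves to eps, starting with the idempotent. *)
Inductive transport : P -> W -> Prop :=
| transport0 : transport (@all_pos m) pos_idem
| isT_move g eps y : descends g eps -> transport (act_move g eps) y ->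
  transport eps (gen_move g * y).

Lemma transport_inv eps y : transport eps y -> (eps = @all_pos m /\ y = pos_idem) \/
  exists g z, [/\ descends g eps, transport (act_move g eps) z & y = gen_move g * z].
Proof. by case=> [|g {}eps z d hz]; [left | right; exists g, z]. Qed.

Lemma transport_ex eps : exists y, transport eps y.
Proof.
have [n] := ubnP (height eps); elim: n => // n IH in eps *; rewrite ltnS => hn.
have [->|[g dg]] := descendsP eps; first by exists pos_idem; exact: transport0.
have [y hy] := IH _ (leq_trans (height_act_move dg) hn).
by exists (gen_move g * y); exact: isT_move.
Qed.

(** Two last moves cannot take place at overlapping positions, so they commute. *)
Lemma descends_comm g g' eps : descends g eps -> descends g' eps -> g = g' \/
  [/\ descends g' (act_move g eps), descends g (act_move g' eps),
      act_move g (act_move g' eps) = act_move g' (act_move g eps) & gen_move g *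
        gen_move g' = gen_move g' * gen_move g].
Proof.
case: g g' => [h|k] [h'|k'] /=.
- by left; congr Mpi; exact: bool_irrelevance.
- move=> e0 /andP[e1 e2]; right.
  have k0 : k' != 0%N :> nat.
    apply: contraNneq e1 => k0; rewrite (_ : lo k' = Ordinal h) //.
    by apply/val_inj; rewrite /= k0.
  have f1 : flip_sign eps (lo k') = eps (lo k') by rewrite ffunE /= (negbTE k0).
  have f2 : flip_sign eps (hi k') = eps (hi k') by rewrite ffunE.
  rewrite f1 f2 e1 e2 flip_sign_swap_sign_far // swap_sign_at_far ?e0 -?val_eqE /=; try lia.
  by split=> //; exact/famW/vv_ps.
- move=> /andP[e1 e2] e0; right.
  have k0 : k != 0%N :> nat.
    apply: contraNneq e1 => k0; rewrite (_ : lo k = Ordinal h') //.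
    by apply/val_inj; rewrite /= k0.
  have f1 : flip_sign eps (lo k) = eps (lo k) by rewrite ffunE /= (negbTE k0).
  have f2 : flip_sign eps (hi k) = eps (hi k) by rewrite ffunE.
  rewrite f1 f2 e1 e2 -flip_sign_swap_sign_far // swap_sign_at_far ?e0 -?val_eqE /=;
    try lia.
  by split=> //; exact/esym/famW/vv_ps.
- move=> /andP[e1 e2] /andP[e1' e2'].
  have [kk|kk] := eqVneq k k'; [by left; rewrite kk | right].
  have far : (k.+1 < k')%N || (k'.+1 < k)%N.
    have n1 : k' != k.+1 :> nat by apply: contraNneq e1' => /hi_lo <-.
    have n2 : k != k'.+1 :> nat by apply: contraNneq e1 => /hi_lo <-.
    by move: kk; rewrite -val_eqE /=; lia.
  rewrite !swap_sign_at_far ?e1 ?e2 ?e1' ?e2' -?val_eqE /=; try lia.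
  by split=> //; [exact: swap_sign_far | exact/famW/vv_klr/klr_ss].
Qed.

(** A diamond argument: paths with different last moves can be prolonged backwards
to a common pattern, where descends_comm applies. *)
Lemma transport_uniq eps y y' : transport eps y -> transport eps y' -> y = y'.
Proof.
have [n] := ubnP (height eps); elim: n => // n IH in eps y y' *; rewrite ltnS => hn.
move=> /transport_inv[[-> ->]|[g [z [dg hz ->]]]] /transport_inv[[e0
  ->]|[g' [z' [dg' hz' ->]]]].
- by [].
- by rewrite descends0 in dg'.
- by rewrite e0 descends0 in dg.
have lg := leq_trans (height_act_move dg) hn;
  have lg' := leq_trans (height_act_move dg') hn.
have [gg|[d1 d2 c1 c2]] := descends_comm dg dg'.
  by subst g'; rewrite (IH _ _ _ lg hz hz').
have [w hw] := transport_ex (act_move g (act_move g' eps)).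
have h1 : transport (act_move g eps) (gen_move g' * w) by apply: isT_move => //;
  rewrite -c1.
have h2 : transport (act_move g' eps) (gen_move g * w) by exact: isT_move.
by rewrite (IH _ _ _ lg hz h1) (IH _ _ _ lg' hz' h2) !mulrA c2.
Qed.

Lemma pos_idemEr j : e (inc j) * pos_idem = e (inc j).
Proof.
rewrite mulr_sumr (bigD1 j) //= vvEE eqxx big1 ?addr0 // => j' jj.
rewrite vvEE ifN //; apply: contra jj => /eqP jj; apply/eqP/val_inj.
apply: eq_from_tnth => l; have := congr1 (fun v : VW => tnth (val v) l) jj.
by rewrite /= !tnth_fold_word !strand_at0.
Qed.

Lemma pos_idemEl j : pos_idem * e (inc j) = e (inc j).
Proof.
rewrite mulr_suml (bigD1 j) //= vvEE eqxx big1 ?addr0 // => j' jj.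
rewrite vvEE ifN //; apply: contra jj => /eqP jj; apply/eqP/val_inj.
apply: eq_from_tnth => l; have := congr1 (fun v : VW => tnth (val v) l) jj.
by rewrite /= !tnth_fold_word !strand_at0.
Qed.

Lemma pos_idem_idem : pos_idem * pos_idem = pos_idem.
Proof. by rewrite {2}/pos_idem mulr_sumr; apply: eq_bigr => j _; exact: pos_idemEl. Qed.

Lemma transport_pos_idem eps y : transport eps y -> y * pos_idem = y.
Proof.
by elim=> [|g {}eps z _ _ IH]; rewrite ?pos_idem_idem // -mulrA IH.
Qed.

Lemma descends_neq k eps : descends (Msig k) eps -> eps (lo k) != eps (hi k).
Proof. by move=> /andP[]; case: (eps (lo k)); case: (eps (hi k)). Qed.

Lemma transport_E eps y j : transport eps y -> e (folded eps j) * y = y * kap (E j).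
Proof.
rewrite kapE; elim=> [|[h|k] {}eps z d hz IH] /=.
- by rewrite pos_idemEl pos_idemEr.
- rewrite mulrA -(@vvPE h (folded (flip_sign eps) j));
  last by rewrite /= -fold_flip_sign flip_signK.
  by rewrite -!mulrA IH.
- rewrite mulrA -(@vvSE k (folded (swap_sign k eps) j)); last first.
    by rewrite /= -fold_swap_sign ?swap_signK //
      !ffunE swap_pos_lo swap_pos_hi eq_sym descends_neq.
  by rewrite -!mulrA IH.
Qed.

(** To slide a through T_eps, one may treat the words of nut one by one. *)
Lemma transport_ext eps (a : W) b y : transport eps y ->
  (forall j, a * e (folded eps j) * y = y * kap (b * E j)) -> a * y = y * kap b.
Proof.
move=> hy h; have e1 : y = \sum_(j : KW) y * kap (E j).
  by rewrite -mulr_sumr -raddf_sum (klrE1 famR) kap1 (transport_pos_idem hy).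
rewrite {1}e1 mulr_sumr -[b]mulr1 -(klrE1 famR) mulr_sumr raddf_sum mulr_sumr.
by apply: eq_bigr => j _; rewrite -h -mulrA transport_E.
Qed.

Lemma transport_ext0 eps (a b : W) y : transport eps y ->
  (forall j, a * e (folded eps j) = b * e (folded eps j)) -> a * y = b * y.
Proof.
move=> hy h; have e1 : y = \sum_(j : KW) y * kap (E j).
  by rewrite -mulr_sumr -raddf_sum (klrE1 famR) kap1 (transport_pos_idem hy).
rewrite e1 !mulr_sumr; apply: eq_bigr => j _.
by rewrite -(transport_E _ hy) !mulrA h.
Qed.

Lemma pos_idemX l : pos_idem * x l = x l * pos_idem.
Proof. by rewrite mulr_sumr mulr_suml; apply: eq_bigr => j _; rewrite vvXE. Qed.

(** Every step of the path crosses distinct letters or is a pi, so the variables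
pass without correction. *)
Lemma transport_x eps y l : transport eps y -> x l * y =
  y * kap (strand_x X (strand_at eps l)).
Proof.
move=> hy; elim: hy l => [|[h|k] {}eps z d hz IH] l /=.
- rewrite strand_at0 /strand_x /= kapX mulrA.
  by rewrite pos_idemX -mulrA pos_idem_idem.
- have hx : x l * pi h = pi h * (if l == 0%N :> nat then - x l else x l).
    have /famW := vv_px q (T := VW) val x sg pi e h l.
    by case: ifP => _; rewrite ?mulrN => ->; rewrite ?opprK.
  have IHl := IH l; rewrite strand_at_flip_sign in IHl.
  rewrite mulrA hx -!mulrA; congr (_ * _); move: IHl.
  by case: ifP => _; rewrite ?strand_x_opp ?mulNr => ->; rewrite ?raddfN ?mulrN ?opprK.
- rewrite mulrA (_ : x l * sg k * z = sg k * x (swap_pos k l) * z).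
    by rewrite -!mulrA IH strand_at_swap_sign ?swap_posK ?descends_neq // -[in X in _ =
      X](swap_signK k eps) strand_at_swap_sign //
        !ffunE swap_pos_lo swap_pos_hi eq_sym descends_neq.
  apply: (transport_ext0 hz) => j.
  have := vvSX k (swap_pos k l) (folded (swap_sign k eps) j).
  rewrite /demazure_coef !tnth_folded (strand_letter_neq hsum); last first.
    by rewrite /= !ffunE swap_pos_lo swap_pos_hi eq_sym descends_neq.
  by rewrite mul0r mulrBl swap_posK => /eqP; rewrite subr_eq0 => /eqP.
Qed.

Lemma transport_quad_poly a b u v u' v' eps y : transport eps y -> u * y =
  y * kap u' -> v * y = y * kap v' ->
  quad_poly a b u v * y = y * kap (@quad_poly K p lam R a b u' v').
Proof.
move=> hy hu hv.
have hB (a1 a2 : W) b1 b2 : a1 * y = y * kap b1 -> a2 * y = y * kap b2 ->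
    (a1 - a2) * y = y * kap (b1 - b2).
  by move=> h1 h2; rewrite raddfB mulrBl mulrBr h1 h2.
rewrite /quad_poly; do !case: ifP => _; [| | exact: hB | exact: hB |].
- by rewrite raddf0 mul0r mulr0.
- by rewrite kapM mulrA -(hB _ _ _ _ hv hu) -mulrA (hB _ _ _ _ hu hv) mulrA.
- by rewrite kap1 mul1r (transport_pos_idem hy).
Qed.

Lemma transport_pi_poly a u u' eps y : transport eps y -> u * y = y * kap u' ->
  pi_poly q a u * y = y * kap (@pi_poly K p q lam R a u').
Proof.
move=> hy hu; rewrite /pi_poly; do !case: ifP => _ //.
  by rewrite raddfN mulNr mulrN hu.
by rewrite kap1 mul1r (transport_pos_idem hy).
Qed.

Lemma fold_all_pos (v : m.-tuple I) : fold_word (@all_pos m) v = v.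
Proof. by apply: eq_from_tnth => l; rewrite tnth_fold_word strand_at0. Qed.

Lemma pos_idemS k : pos_idem * sg k = sg k * pos_idem.
Proof.
rewrite mulr_sumr mulr_suml (reindex_inj (inv_inj (@klr_swapK _ _ _ _ nut k))) /=.
apply: eq_bigr => j _; rewrite (@vvSE k _ (inc (klr_swap k j))) //.
by rewrite /= !fold_all_pos.
Qed.

Lemma transport_braid0 eps y k k' : transport eps y -> k' = k.+1 :> nat ->
  eps (lo k) != eps (hi k') ->
  sg k' * (sg k * (sg k' * y)) = sg k * (sg k' * (sg k * y)).
Proof.
move=> hy kk ne; rewrite !mulrA; apply: (transport_ext0 hy) => j.
have := vvSSS (folded eps j) kk;
  rewrite /braid_coef !tnth_folded (strand_letter_neq hsum) // mul0r.
by rewrite mulrBl => /eqP; rewrite subr_eq0 => /eqP.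
Qed.

Lemma transport_vv_braid0 eps y h k : transport eps y -> k = 0%N :> nat ->
  eps (lo k) = eps (hi k) ->
  sg k * (pi h * (sg k * (pi h * y))) = pi h * (sg k * (pi h * (sg k * y))).
Proof.
move=> hy kk ek; rewrite !mulrA; apply: (transport_ext0 hy) => j.
have := vvPS h (folded eps j) kk; rewrite /pi_braid_term !tnth_folded.
have -> : (Iorb_val (strand_letter (strand_at eps (lo k)) (val j)))^-1 ==
    Iorb_val (strand_letter (strand_at eps (hi k)) (val j)) = false.
  apply/negbTE; have : strand_letter (strand_opp (strand_at eps (lo k))) (val j) !=
    strand_letter (strand_at eps (hi k)) (val j).
    by apply: (strand_letter_neq hsum); rewrite /= ek; case: (eps _).
  by rewrite strand_letter_opp -val_eqE.
by rewrite /= !expr2 mulrBl !mulrA => /eqP; rewrite subr_eq0 => /eqP.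
Qed.

(** If the last move is far from k it commutes with sigma_k. If it touches
position k or k + 1, the signs there determine the moves that precede it, and a
braid relation takes sigma_k past all of them; the correction term vanishes on
these sign patterns. *)
Lemma transport_cross eps y k : transport eps y -> eps (lo k) = eps (hi k) ->
  sg k * y = y * kap (cross S (strand_at eps (lo k)) (strand_at eps (hi k))).
Proof.
have [n] := ubnP (height eps); elim: n => // n IH in eps y k *; rewrite ltnS => hn.
move=> hy ek; have [[e0 ->]|[g [z [dg hz ey]]]] := transport_inv hy.
  rewrite e0 !strand_at0 /cross /= (minn_idPl _) // valK kapS mulrA pos_idemS.
  by rewrite -mulrA pos_idem_idem.
have lg := leq_trans (height_act_move dg) hn; subst y.
case: g dg hz lg hy => [h|l] dg hz lg hy.
  have [k0|k0] := eqVneq (k : nat) 0%N; last first.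
    have -> : sg k * (pi h * z) = pi h * (sg k * z).
      by rewrite !mulrA; congr (_ * _); exact/esym/famW/vv_ps.
    have ek' : flip_sign eps (lo k) = flip_sign eps (hi k) by rewrite !ffunE /= (negbTE k0).
    by rewrite (IH _ _ _ lg hz ek') !strand_at_flip_sign /= (negbTE k0) mulrA.
  have lo0 : Ordinal h = lo k by apply/val_inj; rewrite /= k0.
  rewrite /= lo0 in dg.
  have d1 : descends (Msig k) (flip_sign eps) by rewrite /= !ffunE /= k0 dg -ek dg.
  have [z2 hz2] := transport_ex (swap_sign k (flip_sign eps)).
  have ez := transport_uniq hz (isT_move d1 hz2).
  have d2 : descends (Mpi h) (swap_sign k (flip_sign eps)).
    by rewrite /= lo0 !ffunE swap_pos_lo /= -ek dg.
  have [z3 hz3] := transport_ex (flip_sign (swap_sign k (flip_sign eps))).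
  have ez2 := transport_uniq hz2 (isT_move d2 hz3).
  have ek3 : flip_sign (swap_sign k (flip_sign eps)) (lo k) =
    flip_sign (swap_sign k (flip_sign eps)) (hi k).
    by rewrite !ffunE swap_pos_lo swap_pos_hi /= k0 /= -ek dg.
  have l3 := ltn_trans (height_act_move d2) (ltn_trans (height_act_move d1) lg).
  rewrite ez ez2 /= (transport_vv_braid0 _ hz3) // (IH _ _ _ l3 hz3 ek3) !mulrA.
  rewrite crossC !strand_at_flip_sign /= k0 /=.
  by rewrite !strand_at_swap_sign ?descends_neq //
    swap_pos_lo swap_pos_hi !strand_at_flip_sign /= k0.
have kl : k != l.
  by apply/eqP => kl; move: (descends_neq dg); rewrite -kl ek eqxx.
have dl := descends_neq dg; move/andP: (dg) => [dl1 dl2].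
have [kl'|kl'] := eqVneq (l : nat) k.+1.
  have hl := hi_lo kl'; have [n1 n2 n3 n4] := pos_neq kl'.
  have s1 : swap_sign l eps (lo k) = eps (lo k).
    by rewrite swap_sign_at_far.
  have s2 : swap_sign l eps (hi k) = true by rewrite hl ffunE swap_pos_lo.
  have d1 : descends (Msig k) (swap_sign l eps) by rewrite /= s1 s2 ek hl dl1.
  have [z2 hz2] := transport_ex (swap_sign k (swap_sign l eps)).
  have ez := transport_uniq hz (isT_move d1 hz2).
  have s3 : swap_sign k (swap_sign l eps) (lo k) = true by rewrite ffunE swap_pos_lo.
  have s4 : swap_sign k (swap_sign l eps) (hi k) = eps (lo k) by rewrite ffunE swap_pos_hi.
  have s5 : swap_sign k (swap_sign l eps) (hi l) = eps (lo k).
    by rewrite swap_sign_at_far // ffunE swap_pos_hi ek hl.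
  have ek2 : swap_sign k (swap_sign l eps) (lo l) =
    swap_sign k (swap_sign l eps) (hi l) by rewrite -hl s4 s5.
  have l2 := ltn_trans (height_act_move d1) lg.
  have br := transport_braid0 hz2 kl'; rewrite s3 s5 ek hl (negbTE dl1) in br.
  rewrite ez /= -br // (IH _ _ _ l2 hz2 ek2) !mulrA.
  congr (_ * kap (cross S _ _)).
    by rewrite -hl strand_at_swap_sign ?descends_neq // swap_pos_hi strand_at_swap_sign_far.
  by rewrite strand_at_swap_sign_far // strand_at_swap_sign // swap_pos_hi hl.
have [lk'|lk'] := eqVneq (k : nat) l.+1.
  have hl := hi_lo lk'; have [n1 n2 n3 n4] := pos_neq lk'.
  have s1 : swap_sign l eps (hi k) = true.
    by rewrite swap_sign_at_far // -ek -hl.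
  have s2 : swap_sign l eps (lo k) = false by rewrite -hl ffunE swap_pos_hi (negbTE dl1).
  have d1 : descends (Msig k) (swap_sign l eps) by rewrite /= s1 s2.
  have [z2 hz2] := transport_ex (swap_sign k (swap_sign l eps)).
  have ez := transport_uniq hz (isT_move d1 hz2).
  have s3 : swap_sign k (swap_sign l eps) (lo l) = true.
    by rewrite swap_sign_at_far // ffunE swap_pos_lo.
  have s4 : swap_sign k (swap_sign l eps) (lo k) = true by rewrite ffunE swap_pos_lo.
  have s5 : swap_sign k (swap_sign l eps) (hi k) = false by rewrite ffunE swap_pos_hi.
  have ek2 : swap_sign k (swap_sign l eps) (lo l) =
    swap_sign k (swap_sign l eps) (hi l) by rewrite hl s3 s4.
  have l2 := ltn_trans (height_act_move d1) lg.
  have br := transport_braid0 hz2 lk'; rewrite s3 s5 in br.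
  rewrite ez /= br // (IH _ _ _ l2 hz2 ek2) !mulrA.
  congr (_ * kap (cross S _ _)).
    by rewrite strand_at_swap_sign_far // strand_at_swap_sign // swap_pos_lo hl.
  by rewrite hl strand_at_swap_sign ?descends_neq // swap_pos_lo strand_at_swap_sign_far.
have far : (k.+1 < l)%N || (l.+1 < k)%N.
  by move: kl kl' lk'; rewrite -val_eqE /=; lia.
have -> : sg k * (sg l * z) = sg l * (sg k * z).
  by rewrite !mulrA; congr (_ * _); exact/famW/vv_klr/klr_ss.
have ek' : swap_sign l eps (lo k) = swap_sign l eps (hi k).
  by rewrite !swap_sign_at_far // -val_eqE /=; lia.
rewrite (IH _ _ _ lg hz ek') mulrA !strand_at_swap_sign_far // -val_eqE /=; lia.
Qed.

Lemma transport_sigma eps y y' k : transport eps y -> transport (swap_sign k eps) y' ->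
  sg k * y' = y * kap (sigma_entry X S E k eps).
Proof.
rewrite /sigma_entry /sigma_coef => hy hy'; case: ifP => [/eqP ek|/negbT ek].
  by rewrite swap_sign_same // in hy'; rewrite (transport_uniq hy' hy);
    exact: transport_cross.
case e1: (strand_at eps (lo k)).1; last first.
  have d : descends (Msig k) eps by move: ek; rewrite /= [eps (lo k)]e1; case: (eps (hi k)).
  have := isT_move d hy'; rewrite kap1 (transport_pos_idem hy) => hy2.
  exact: transport_uniq hy2 hy.
have d : descends (Msig k) (swap_sign k eps).
  
  move: ek; rewrite /= !ffunE swap_pos_lo swap_pos_hi [eps (lo k)]e1.
  by case: (eps (hi k)).
have := isT_move d; rewrite /= swap_signK => /(_ _ hy) hy2.
rewrite (transport_uniq hy' hy2) mulrA; apply: (transport_ext hy) => j.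
rewrite (quadE famR) kapM mulrA -expr2 vvSS /quad_coef -/(quad_poly _ _ _ _).
rewrite -(transport_quad_poly _ _ hy (transport_x (lo k) hy) (transport_x (hi k) hy))
  -!mulrA -(transport_E _ hy).
by rewrite !mulrA /quad_poly !tnth_folded.
Qed.

Lemma transport_pi eps y y' h : transport eps y -> transport (flip_sign eps) y' ->
  pi h * y' = y * kap (pi_entry q X E h eps).
Proof.
rewrite /pi_entry /pi_coef => hy hy'; case: ifP => e1.
  have := isT_move (g := Mpi h) e1 hy'; rewrite kap1 (transport_pos_idem hy) => hy2.
  exact: transport_uniq hy2 hy.
have d : descends (Mpi h) (flip_sign eps) by move: e1; rewrite /= !ffunE /= => ->.
have := isT_move d; rewrite /= flip_signK => /(_ _ hy) hy2.
rewrite (transport_uniq hy' hy2) mulrA; apply: (transport_ext hy) => j.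
rewrite (piquadE _ famR) kapM mulrA -expr2 vvPP /pi_quad_coef -/(pi_poly _ _ _).
rewrite -(transport_pi_poly _ hy (transport_x (Ordinal h) hy)) -!mulrA -(transport_E _ hy).
by rewrite !mulrA /pi_poly !tnth_folded.
Qed.

Lemma transport_e eps y i : transport eps y -> e i * y = y * kap (e_entry hnut E i eps).
Proof.
move=> hy; apply: (transport_ext hy) => j; rewrite (e_entry_E _ famR) vvEE eq_sym.
case: ifP => [/eqP ij|_]; last by rewrite mul0r raddf0 mulr0.
by rewrite -(transport_E _ hy) ij.
Qed.

End Transport.

(** * The isomorphism *)

(** The scalars as a central subring, in the form required by the universal
property. *)
Lemma presented_scale (K : fieldType) (F : algType K) (rel : F -> F -> Prop) :
  exists kap : {rmorphism K -> presented rel},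
    forall c y, (kap c * y = c *: y) * (y * kap c = c *: y).
Proof.
pose kap (c : K) : presented rel := c *: (1 : presented rel).
have kz : zmod_morphism kap by move=> a b; exact: scalerBl.
have km : monoid_morphism kap.
  split=> [|a b]; first exact: scale1r.
  by rewrite /kap -pres_scaleAl mul1r scalerA.
exists (HB.pack_for {rmorphism K -> presented rel} kap
  (GRing.isZmodMorphism.Build _ _ kap kz) (GRing.isMonoidMorphism.Build _ _ kap km)).
by move=> c y; split; rewrite /= /kap -?pres_scaleAl -?pres_scaleAr ?mul1r ?mulr1.
Qed.

Lemma corner_scale (K : fieldType) (F : algType K) (rel : F -> F -> Prop)
    (e : idempotent_of (presented rel)) :
  exists kap : {rmorphism K -> corner e},
    forall c y, (kap c * y = c *: y) * (y * kap c = c *: y).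
Proof.
pose kap (c : K) : corner e := c *: (1 : corner e).
have kz : zmod_morphism kap by move=> a b; exact: scalerBl.
have km : monoid_morphism kap.
  split=> [|a b]; first exact: scale1r.
  by rewrite /kap -corner_scaleAl mul1r scalerA.
exists (HB.pack_for {rmorphism K -> corner e} kap
  (GRing.isZmodMorphism.Build _ _ kap kz) (GRing.isMonoidMorphism.Build _ _ kap km)).
by move=> c y; split; rewrite /= /kap -?corner_scaleAl -?corner_scaleAr ?mul1r ?mulr1.
Qed.

Lemma scalar_mulmxE (R : pzRingType) n (c : R) (A : 'M[R]_n) i j :
  (c%:M *m A) i j = c * A i j.
Proof. by rewrite mul_scalar_mx mxE. Qed.

Lemma mulmx_scalarE (R : pzRingType) n (c : R) (A : 'M[R]_n) i j :
  (A *m c%:M) i j = A i j * c.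
Proof.
rewrite mxE (bigD1 j) //= mxE eqxx mulr1n big1 ?addr0 // => k kj.
by rewrite mxE (negbTE kj) mulr0.
Qed.

Section Isomorphism.

Variables (K : fieldType) (p q lam : K) (m : nat).
Variables nu nut : {mset Iorb p lam}%mset.
Hypothesis hp : p != 0.
Hypothesis hnut : nu = (nut `+` mset_inv nut)%mset.
Hypothesis hsum : forall i : Iorb p lam,
     ~~ ((1 <= nut i)%N && (1 <= nut (Iinv i))%N).
Local Notation I := (Iorb p lam).
Local Notation KW := (klr_word m nut).
Local Notation VW := (vv_word m nu).
Local Notation P := {ffun 'I_m -> bool}.
Local Notation R := (klr_algebra m nut).
Local Notation W := (vv_algebra q m nu).

Let famR := @klr_algebraP K p lam m nut.
Let famW := @vv_algebraP K p q lam m nu.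

Local Notation inc := (folded hnut (@all_pos m)).
Local Notation eb := (pos_idem hnut (@We K p q lam m nu)).

Definition pos_idempotent : idempotent_of W := IdempotentOf (pos_idem_idem hnut famW).
Local Notation C := (corner pos_idempotent).

Lemma matrix_representation : exists Phi : {rmorphism W -> 'M[R]_#|P|},
  (forall c w a b, Phi (c *: w) a b = c *: Phi w a b) /\
  [/\ forall l, Phi (Wx q nu l) = x_mx (@Rx K p lam m nut) l,
      forall k, Phi (Ws q nu k) = sigma_mx (@Rx _ _ _ m nut) (@Rs _ _ _ m nut) (@Re _ _
        _ m nut) k,
      forall h, Phi (Wpi q nu h) = pi_mx q (@Rx _ _ _ m nut) (@Re _ _ _ m nut) h
    & forall i, Phi (We q i) = e_mx hnut (@Re _ _ _ m nut) i].
Proof.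
have [kap kapE] := presented_scale (klr_rel (T := KW) val
  (fun l => freegen K (KlrX nut l)) (fun k => freegen K (KlrS nut k))
    (fun i => freegen K (KlrE i))).
pose kapM (c : K) : 'M[R]_#|P| := (kap c)%:M.
have kz : zmod_morphism kapM by move=> a b; rewrite /kapM rmorphB raddfB.
have km : monoid_morphism kapM.
  split=> [|a b]; first by rewrite /kapM rmorph1.
  by rewrite /kapM rmorphM; exact: scalar_mxM.
pose kM : {rmorphism K -> 'M[R]_#|P|} := HB.pack_for {rmorphism K -> 'M[R]_#|P|} kapM
  (GRing.isZmodMorphism.Build _ _ kapM kz) (GRing.isMonoidMorphism.Build _ _ kapM km).
have [c a|Phi [PhiZ PhiE]] := vv_algebra_lift (kap := kM) _
   (vv_matrices (q := q) (hnut := hnut) hp hsum famR).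
  apply/matrixP => i j; rewrite /= /kapM.
  rewrite [LHS]scalar_mulmxE [RHS]mulmx_scalarE.
  by rewrite !kapE.
exists Phi; split=> // c w a b; rewrite PhiZ /=.
by rewrite [LHS]scalar_mulmxE kapE.
Qed.

Lemma corner_subproof (u : W) : eb * u = u * eb -> u * eb \in in_corner pos_idempotent.
Proof.
move=> hu; apply/in_cornerP; exists u; rewrite /= hu -mulrA.
by rewrite (pos_idem_idem hnut famW).
Qed.

Let x := @Wx K p q lam m nu.
Let sg := @Ws K p q lam m nu.
Let e := @We K p q lam m nu.

Fact corner_subproofE j : e (inc j) \in in_corner pos_idempotent.
Proof.
by apply/in_cornerP; exists (e (inc j));
  rewrite /= (pos_idemEl hnut famW) (pos_idemEr hnut famW).
Qed.

Definition corner_x l : C := Corner (corner_subproof (pos_idemX hnut famW l)).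
Definition corner_sigma k : C := Corner (corner_subproof (pos_idemS hnut famW k)).
Definition corner_e (j : KW) : C := Corner (corner_subproofE j).

Definition corner_to_W : {additive C -> W} := \val.

Lemma inc_val j : val (inc j) = val j.
Proof. exact: fold_all_pos. Qed.

Lemma inc_eq j j' : (inc j == inc j') = (j == j').
Proof. by rewrite -2!val_eqE !inc_val. Qed.

(** a is the corner u e of an element u that commutes with the idempotent e;
on such elements the relations of W can be used directly. *)
Definition lifts (a : C) (u : W) : Prop := corner_to_W a = u * eb /\ eb * u = u * eb.

Lemma lifts0 : lifts 0 0.
Proof. by split; rewrite ?raddf0 mul0r ?mulr0. Qed.

Lemma lifts1 : lifts 1 1.
Proof. by split; rewrite ?mul1r ?mulr1. Qed.

Lemma liftsB a b u v : lifts a u -> lifts b v -> lifts (a - b) (u - v).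
Proof.
move=> [a1 u1] [b1 v1]; split; first by rewrite raddfB a1 b1 mulrBl.
by rewrite mulrBl mulrBr u1 v1.
Qed.

Lemma liftsD a b u v : lifts a u -> lifts b v -> lifts (a + b) (u + v).
Proof.
move=> [a1 u1] [b1 v1]; split; first by rewrite raddfD a1 b1 mulrDl.
by rewrite mulrDl mulrDr u1 v1.
Qed.

Lemma liftsN a u : lifts a u -> lifts (- a) (- u).
Proof.
by move=> h; rewrite -[- a]sub0r -[- u]sub0r; apply: liftsB h; exact: lifts0.
Qed.

Lemma liftsM a b u v : lifts a u -> lifts b v -> lifts (a * b) (u * v).
Proof.
move=> [a1 u1] [b1 v1]; split.
  rewrite -[LHS]/(corner_to_W a * corner_to_W b) a1 b1 -!mulrA [eb * (v * _)]mulrA v1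
    -mulrA.
  by rewrite (pos_idem_idem hnut famW).
by rewrite mulrA u1 -!mulrA v1.
Qed.

Lemma liftsX l : lifts (corner_x l) (x l).
Proof. by split=> //; exact: (pos_idemX hnut famW). Qed.
Lemma liftsS k : lifts (corner_sigma k) (sg k).
Proof. by split=> //; exact: (pos_idemS hnut famW). Qed.

Lemma lifts_quad k j :
  lifts (quad_coef (T := KW) val corner_x k j) (quad_coef (T := VW) val x k (inc j)).
Proof.
have hX := liftsX; rewrite /quad_coef inc_val; do !case: ifP => _;
  by [exact: lifts0 | exact: lifts1 | exact: liftsB | apply: liftsM; exact: liftsB].
Qed.

Lemma lifts_braid k k' j :
  lifts (braid_coef (T := KW) val corner_x k k' j) (braid_coef (T := VW) val x k k'
    (inc j)).
Proof.
have hX := liftsX; rewrite /braid_coef inc_val !mulr2n.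
do !case: ifP => _; [exact: lifts0 | | exact: lifts1
  | by apply: liftsN; exact: lifts1 | exact: lifts0].
by do 2![apply: liftsB => //]; exact: liftsD.
Qed.

Lemma lifts_demazure k l j :
  lifts (demazure_coef (T := KW) val C k l j) (demazure_coef (T := VW) val W k l (inc j)).
Proof.
rewrite /demazure_coef inc_val; do !case: ifP => _;
  by [exact: lifts0 | exact: lifts1 | apply: liftsN; exact: lifts1].
Qed.

Lemma lifts_corner_e a u j : lifts a u -> corner_to_W (a * corner_e j) = u * e (inc j).
Proof.
by move=> [a1 _]; rewrite -[LHS]/(corner_to_W a * e (inc j)) a1
  -mulrA (pos_idemEl hnut famW).
Qed.

Lemma lifts_corner_e_eq a b u v j : lifts a u -> lifts b v ->
  u * e (inc j) = v * e (inc j) -> a * corner_e j = b * corner_e j.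
Proof.
move=> ha hb h; apply: val_inj; rewrite -[LHS]/(corner_to_W _) -[RHS]/(corner_to_W _).
by rewrite (lifts_corner_e _ ha) (lifts_corner_e _ hb).
Qed.

Lemma corner_e_lifts a u j : lifts a u -> corner_to_W (corner_e j * a) = e (inc j) * u.
Proof.
by move=> [a1 u1]; rewrite -[LHS]/(e (inc j) * corner_to_W a) a1
  -u1 mulrA (pos_idemEr hnut famW).
Qed.

Lemma lifts_eq a b u v : lifts a u -> lifts b v -> u = v -> a = b.
Proof.
move=> [ha _] [hb _] uv; apply: val_inj.
by rewrite -[LHS]/(corner_to_W _) -[RHS]/(corner_to_W _) ha hb uv.
Qed.

Lemma corner_family : klr_family (T := KW) val corner_x corner_sigma corner_e.
Proof.
have hX := liftsX; have hS := liftsS.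
have hSS k k' : lifts (corner_sigma k * corner_sigma k') (sg k * sg k') by exact: liftsM.
move=> _ _ [i j|k i j ij|l i||l l'|k i|j k h|k k' i h|k l i].
- apply: val_inj; rewrite -[LHS]/(e (inc i) * e (inc j)) (vvEE famW) inc_eq.
  by case: ifP => _; last rewrite -[RHS]/(corner_to_W _) raddf0.
- apply: val_inj; rewrite -[LHS]/(corner_to_W _) -[RHS]/(corner_to_W _).
  rewrite (lifts_corner_e _ (hS k)) (corner_e_lifts _ (hS k)); apply: (vvSE famW).
  by rewrite !inc_val.
- apply: val_inj; rewrite -[LHS]/(corner_to_W _) -[RHS]/(corner_to_W _).
  by rewrite (lifts_corner_e _ (hX l)) (corner_e_lifts _ (hX l)) (vvXE famW).
- by apply: val_inj; rewrite -[LHS]/(corner_to_W _) raddf_sum.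
- apply: lifts_eq (liftsM (hX _) (hX _)) (liftsM (hX _) (hX _)) _.
  exact/famW/vv_klr/klr_xx.
- rewrite expr2; apply: lifts_corner_e_eq (hSS _ _) (lifts_quad _ _) _.
  by rewrite -expr2 (vvSS famW).
- apply: lifts_eq (hSS _ _) (hSS _ _) _; exact/famW/vv_klr/klr_ss.
- apply: lifts_corner_e_eq (liftsB (liftsM (hSS _ _) (hS _)) (liftsM (hSS _ _) (hS _)))
    (lifts_braid _ _ _) _.
  exact: (vvSSS famW).
- apply: lifts_corner_e_eq (liftsB (liftsM (hS _) (hX _)) (liftsM (hX _) (hS _)))
    (lifts_demazure _ _ _) _.
  exact: (vvSX famW).
Qed.

Lemma klr_to_corner : exists h : {rmorphism R -> C},
  (forall c y, h (c *: y) = c *: h y) /\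
  [/\ forall l, h (Rx nut l) = corner_x l, forall k, h (Rs nut k) = corner_sigma k
    & forall j, h (Re j) = corner_e j].
Proof.
have [kap kapE] := corner_scale pos_idempotent.
have [c a|h [hZ hE]] := klr_algebra_lift (kap := kap) _ corner_family.
  by rewrite !kapE.
by exists h; split=> // c y; rewrite hZ kapE.
Qed.

Lemma monomial_mx_rank (Q : pzRingType) (A : P -> Q) t a b :
  monomial_mx A t (enum_rank a) (enum_rank b) = A a *+ (b == t a).
Proof. by rewrite mxE !enum_rankK. Qed.

Local Notation rk0 := (enum_rank (@all_pos m)).
Local Notation X := (@Rx K p lam m nut).
Local Notation S := (@Rs K p lam m nut).
Local Notation E := (@Re K p lam m nut).

(** A word with an inverted letter is not a word of nut. *)
Lemma e_entry_plain j eps : eps != @all_pos m -> e_entry hnut E (inc j) eps = 0.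
Proof.
move=> ne; rewrite /e_entry big_pred0 // => j'; apply/negbTE/eqP => h.
have [l el] : exists l, eps l.
  apply/existsP; apply: contraNT ne => /existsPn h'; apply/eqP/ffunP => l.
  by rewrite ffunE; apply/negbTE.
have := congr1 (fun v : VW => tnth (val v) l) h; rewrite /= !tnth_fold_word.
by move/(strand_letter_sign hsum); rewrite /strand_at /= el ffunE.
Qed.

Lemma sum_e_entry_plain : \sum_(j : KW) e_entry hnut E (inc j) (@all_pos m) = 1.
Proof.
rewrite -(klrE1 famR); apply: eq_bigr => j _; rewrite /e_entry (big_pred1 j) //.
by move=> j'; exact: inc_eq.
Qed.

Lemma corner_iso_klr : exists e : idempotent_of W, exists f : {linear corner e -> R},
    bijective f /\ monoid_morphism f.
Proof.
have [Phi [PhiZ [PhiX PhiS PhiP PhiE]]] := matrix_representation.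
have [h [hZ [hX hS hE]]] := klr_to_corner.
have Phieb a b : Phi eb (enum_rank a) (enum_rank b) = ((a == @all_pos m) && (b == a))%:R.
  rewrite /pos_idem rmorph_sum summxE /=.
  under eq_bigr do rewrite PhiE monomial_mx_rank.
  rewrite sumrMnl; have [->|ne] := eqVneq a (@all_pos m);
    first by rewrite sum_e_entry_plain.
  by rewrite big1 ?mul0rn // => j _; exact: e_entry_plain.
exists pos_idempotent.
pose f (w : C) : R := Phi (val w) rk0 rk0.
(* On the right the idempotent empties all columns but that of the all-positive
   pattern, so the sum over the columns has one term. *)
have mulE (w w' : W) : w * eb = w ->
    (Phi (w * w')) rk0 rk0 = Phi w rk0 rk0 * Phi w' rk0 rk0.
  move=> hw; rewrite rmorphM mxE (bigD1 rk0) //= [X in _ + X]big1 ?addr0 // => b b0.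
  have -> : Phi w rk0 b = 0; last by rewrite mul0r.
  rewrite -hw rmorphM mxE big1 // => c _; rewrite -(enum_valK b) -(enum_valK c) Phieb.
  case: eqP => [->|_]; last by rewrite mulr0.
  by rewrite -(inj_eq enum_rank_inj) enum_valK (negbTE b0) mulr0.
have fM : monoid_morphism f.
  split; first by rewrite /f Phieb !eqxx.
  by move=> a b; apply: mulE; exact: corner_absr.
have flin : linear f.
  by move=> c a b; rewrite /f linearP /= rmorphD mxE PhiZ.
pose F : {linear C -> R} := HB.pack_for {linear C -> R} f
   (GRing.isLinear.Build _ _ _ _ f flin).
exists F; split; last exact: fM.
have fh r : f (h r) = r.
  (* The corner entry only sees the all-positive entry of the matrix of a. *)
  have fgen (a : W) (c : C) (y : R) : val c = a * eb -> Phi a rk0 rk0 = y -> f c = y.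
    move=> hc <-; rewrite /f hc rmorphM mxE (bigD1 rk0) //= Phieb !eqxx mulr1.
    rewrite big1 ?addr0 // => b b0; rewrite -(enum_valK b) Phieb.
    by rewrite -(inj_eq enum_rank_inj) enum_valK (negbTE b0) mulr0.
  elim/presented_ind: r => [|a b ha hb|c a ha|g a ha].
  - by rewrite rmorph1 fM.1.
  - by rewrite rmorphD -[LHS]/(F _) raddfD /= ha hb.
  - by rewrite hZ -[LHS]/(F _) linearZ /= ha.
  rewrite rmorphM fM.2 ha; congr (_ * _); case: g => [l|k|j].
  - rewrite -/(Rx nut l) hX; apply: (fgen (x l)) => //.
    by rewrite PhiX monomial_mx_rank eqxx mulr1n /x_entry strand_at0.
  - rewrite -/(Rs nut k) hS; apply: (fgen (sg k)) => //.
    rewrite PhiS monomial_mx_rank swap_sign_same ?ffunE //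
      eqxx mulr1n /sigma_entry !strand_at0.
    by rewrite /sigma_coef /= /cross /= (minn_idPl _) // valK.
  - rewrite -/(Re j) hE; apply: (fgen (e (inc j))); first by rewrite (pos_idemEr hnut famW).
    rewrite PhiE monomial_mx_rank eqxx mulr1n /e_entry (big_pred1 j) //.
    by move=> j'; exact: inc_eq.
have [kap kapV] : exists kap : {additive R -> W}, forall r, kap r = val (h r).
  by exists (corner_to_W \o h).
have kapM : {morph kap : a b / a * b} by move=> a b; rewrite !kapV rmorphM.
have kap1 : kap 1 = eb by rewrite kapV rmorph1.
have kapX l : kap (X l) = x l * eb by rewrite kapV hX.
have kapS k : kap (S k) = sg k * eb by rewrite kapV hS.
have kapE j : kap (E j) = e (inc j) by rewrite kapV hE.
have kapZ c r : kap (c *: r) = c *: kap r by rewrite !kapV hZ.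
pose pi := @Wpi K p q lam m nu.
have [T hT] := choice (transport_ex hnut sg pi e).
have T0 : T (@all_pos m) = eb.
  exact: (transport_uniq famW (hT _) (transport0 hnut sg pi e)).
(* Stable under left multiplication by generators, because they slide through T
   with the entries of their matrices as coefficients. *)
have key (w : W) : w * eb = \sum_eps T eps * kap (Phi w (enum_rank eps) rk0).
  elim/presented_ind: w => [|a b ha hb|c a ha|g a ha].
  - rewrite rmorph1 mul1r (bigD1 (@all_pos m)) //= mxE eqxx mulr1n T0 kap1
    (pos_idem_idem hnut famW).
    rewrite big1 ?addr0 // => eps ne.
    by rewrite mxE (inj_eq enum_rank_inj) (negbTE ne) mulr0n raddf0 mulr0.
  - rewrite mulrDl ha hb -big_split; apply: eq_bigr => eps _ /=.
    by rewrite rmorphD mxE !raddfD mulrDr.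
  - rewrite -[LHS]pres_scaleAl ha scaler_sumr; apply: eq_bigr => eps _.
    by rewrite PhiZ kapZ pres_scaleAr.
  have step A t (u : W) : involutive t -> Phi u = monomial_mx A t ->
      (forall eps, u * T (t eps) = T eps * kap (A eps)) ->
      u * a * eb = \sum_eps T eps * kap (Phi (u * a) (enum_rank eps) rk0).
    move=> tK hu hA; rewrite -mulrA ha mulr_sumr (reindex_inj (inv_inj tK)) /=.
    apply: eq_bigr => eps _; rewrite mulrA hA -mulrA -kapM; congr (_ * kap _).
    rewrite rmorphM hu mxE (bigD1 (enum_rank (t eps))) //= monomial_mx_rank eqxx mulr1n.
    rewrite big1 ?addr0 // => b hb; rewrite -(enum_valK b) monomial_mx_rank.
    by rewrite -(inj_eq enum_rank_inj) enum_valK (negbTE hb) mulr0n mul0r.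
  case: g => [l|k|hm|i].
  - by apply: step (PhiX l) _ => // eps; exact: (transport_x hsum famR famW kap1 kapX kapE).
  - by apply: step (@swap_signK m k) (PhiS k) _ => eps;
    exact: (transport_sigma hsum famR famW kapM kap1 kapX kapS kapE).
  - by apply: step (@flip_signK m) (PhiP hm) _ => eps;
    exact: (transport_pi hsum famR famW kapM kap1 kapX kapE).
  - by apply: step (PhiE i) _ => // eps; exact: (transport_e famR famW kap1 kapE).
exists h => [w|r] //=; apply: val_inj.
have ebT eps : eps != @all_pos m -> eb * T eps = 0.
  move=> ne; rewrite mulr_suml big1 // => j _.
  rewrite (transport_e famR famW kap1 kapE (inc j) (hT eps)).
  by rewrite e_entry_plain // raddf0 mulr0.
rewrite -kapV -[RHS](corner_absl w) -[in RHS](corner_absr w).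
rewrite -[pos_idempotent in RHS]/pos_idempotent [X in _ * X]key mulr_sumr (bigD1
  (@all_pos m)) //=.
rewrite big1 ?addr0 => [|eps ne]; last by rewrite mulrA ebT // mul0r.
by rewrite T0 -[in RHS]kap1 -!kapM !mul1r.
Qed.

End Isomorphism.

Theorem proposition1p17 (K : fieldType) (hK : 2%N \notin [pchar K])
  (p q : K) (hp : p != 0) (hq : q != 0) (hp1 : p != 1) (hpN1 : p != -1)
  (hpq : forall n : int, p != q ^ n) (hqp : forall n : int, q != p ^ n)
  (lam : K) (hlam : lam != 0)
  (hI1 : 1 \notin in_Iorb p lam) (hIN1 : -1 \notin in_Iorb p lam)
  (m : nat) (nu nut : {mset Iorb p lam}%mset)
  (hnu : in_thetaNI nu) (hm : size nu = (2 * m)%N)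
  (hnut : nu = (nut `+` mset_inv nut)%mset)
  (hsum : forall i : Iorb p lam,
     ~~ ((1 <= nut i)%N && (1 <= nut (Iinv i))%N)) :
  exists e : idempotent_of (vv_algebra q m nu),
  exists f : {linear corner e -> klr_algebra m nut},
    bijective f /\ monoid_morphism f.
Proof. exact: (corner_iso_klr q m hp hnut hsum). Qed.
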